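(* Let $\mathcal{H}\subseteq E^{[\infty]}$ be a strategic $(p^+)$-family of block sequences and let $\mathbb{A}\subseteq \mathbb{R}\times E^{[\infty]}$ be analytic. Then there are a nonempty perfect set $P\subseteq\mathbb{R}$ and an $X\in\mathcal{H}$ such that either (i) player I has a strategy $\sigma$ in $F[X]$ such that $P\times[\sigma]\subseteq(\mathbb{R}\times E^{[\infty]})\setminus\mathbb{A}$, or (ii) for every $t\in P$, player II has a strategy in $G[X]$ for playing into $\mathbb{A}_t=\{Y\in E^{[\infty]}:(t,Y)\in\mathbb{A}\}$.
   Context: $F$ is a countable (possibly finite) field and $E$ a countably infinite-dimensional $F$-vector space with fixed basis $(e_n)$. $\mathrm{supp}(v)$ is the set of indices of nonzero coefficients of $v\neq0$. A block sequence is a sequence $(x_n)$ of nonzero vectors with $\max\mathrm{supp}(x_n)<\min\mathrm{supp}(x_{n+1})$. $E^{[\infty]}$ is the Polish space of infinite block sequences (subspace of $E^\omega$, $E$ discrete). $\langle X\rangle$ is the span; $Y\preceq X$ iff $\langle Y\rangle\subseteq\langle X\rangle$; $X/n$ is the tail of $X$ of vectors with support above $n$; $Y\preceq^*X$ iff $Y/n\preceq X$ for some $n$. A family is a nonempty $\mathcal{H}\subseteq E^{[\infty]}$ upward closed under $\preceq^*$; $\mathcal{H}\restriction X=\{Y\in\mathcal{H}:Y\preceq X\}$. $D\subseteq E$ is $\mathcal{H}$-dense below $X\in\mathcal{H}$ if for all $Y\in\mathcal{H}\restriction X$ there is $Z\in E^{[\infty]}$ with $Z\preceq Y$ and $\langle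 Z\rangle\subseteq D$. $\mathcal{H}$ is full if whenever $D$ is $\mathcal{H}$-dense below some $X\in\mathcal{H}$ there is $Z\in\mathcal{H}\restriction X$ with $\langle Z\rangle\subseteq D$. $\mathcal{H}$ is a $(p)$-family if every $\preceq$-decreasing sequence $(X_n)$ in $\mathcal{H}$ has some $X\in\mathcal{H}$ with $X\preceq^*X_n$ for all $n$; a $(p^+)$-family is a full $(p)$-family. $\mathcal{H}$ is strategic if whenever $X\in\mathcal{H}$ and $\alpha$ is a strategy for II in $G[X]$, some outcome of $\alpha$ lies in $\mathcal{H}$. Games: in $F[X]$, I plays $n_k\in\omega$ and II plays nonzero $y_k\in\langle X\rangle$ with $n_k<\min\mathrm{supp}(y_k)$; in $G[X]$, I plays $Y_k\preceq X$ in $E^{[\infty]}$ and II plays nonzero $y_k\in\langle Y_k\rangle$; in both II's moves must form a block sequence, which is the outcome. Strategies are functions from finite sequences of the opponent's moves to moves; ''playing into (out of)'' a set means all outcomes lie in (outside) it; $[\sigma]$ is the set of outcomes of plays where I follows $\sigma$. *)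

(* Defs.v *)
From HB Require Import structures.
From mathcomp Require Import all_boot all_order all_algebra.
From mathcomp Require Import reals.
Set Implicit Arguments. Unset Strict Implicit. Unset Printing Implicit Defensive.
Import Order.TTheory GRing.Theory Num.Theory.
Local Open Scope ring_scope.

Section Defs.
Variable F : countFieldType.

(* E = finitely supported vectors nat -> F, basis e_n = indicator of n. *)
Definition vec := nat -> F.

Definition finsupp (v : vec) : Prop := exists N, forall n, (N <= n)%N -> v n = 0.

Definition is_block (X : nat -> vec) : Prop :=
  (forall n, finsupp (X n) /\ exists k, X n k != 0) /\
  (forall n i j, X n i != 0 -> X n.+1 j != 0 -> (i < j)%N).

Definition span_sub (X : nat -> vec) (P : nat -> Prop) (v : vec) : Prop :=
  exists N (c : nat -> F), (forall i, ~ P i -> c i = 0) /\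
    forall k, v k = \sum_(i < N) c i * X i k.

Definition span (X : nat -> vec) (v : vec) : Prop := span_sub X (fun _ => True) v.

Definition preceq (Y X : nat -> vec) : Prop := forall v, span Y v -> span X v.

Definition tail_idx (X : nat -> vec) (n : nat) (i : nat) : Prop :=
  forall k, X i k != 0 -> (n < k)%N.

Definition preceq_star (Y X : nat -> vec) : Prop :=
  exists n, forall v, span_sub Y (tail_idx Y n) v -> span X v.

Definition is_family (H : (nat -> vec) -> Prop) : Prop :=
  (forall X, H X -> is_block X) /\ (exists X, H X) /\
  (forall X Y, H X -> is_block Y -> preceq_star X Y -> H Y).

Definition dense_below (H : (nat -> vec) -> Prop) (D : vec -> Prop) (X : nat -> vec) :=
  forall Y, H Y -> preceq Y X ->
    exists Z, is_block Z /\ preceq Z Y /\ (forall v, span Z v -> D v).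

Definition full (H : (nat -> vec) -> Prop) : Prop :=
  forall D X, H X -> dense_below H D X ->
    exists Z, H Z /\ preceq Z X /\ (forall v, span Z v -> D v).

Definition p_family (H : (nat -> vec) -> Prop) : Prop :=
  forall Xs : nat -> nat -> vec,
    (forall n, H (Xs n)) -> (forall n, preceq (Xs n.+1) (Xs n)) ->
    exists X, H X /\ forall n, preceq_star X (Xs n).

Definition pplus_family H := p_family H /\ full H.

(* Game G[X]: I plays block Y_k <= X, II plays nonzero y_k in <Y_k>,
   II's moves forming a block sequence. A strategy for II maps the finite
   sequence of I's moves so far to II's move. *)
Definition I_play_G (X : nat -> vec) (Ys : nat -> nat -> vec) : Prop :=
  forall k, is_block (Ys k) /\ preceq (Ys k) X.

Definition outcome_G (alpha : seq (nat -> vec) -> vec) (Ys : nat -> nat -> vec) : nat -> vec :=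
  fun k => alpha (mkseq Ys k.+1).

Definition II_strategy_G (X : nat -> vec) (alpha : seq (nat -> vec) -> vec) : Prop :=
  forall Ys, I_play_G X Ys ->
    is_block (outcome_G alpha Ys) /\ forall k, span (Ys k) (outcome_G alpha Ys k).

Definition strategic (H : (nat -> vec) -> Prop) : Prop :=
  forall X alpha, H X -> II_strategy_G X alpha ->
    exists Ys, I_play_G X Ys /\ H (outcome_G alpha Ys).

(* Game F[X]: I plays n_k, II plays nonzero y_k in <X> with n_k < min supp y_k,
   II's moves forming a block sequence. A strategy for I maps II's moves so far
   to a natural number. [sigma] = outcomes of plays in which I follows sigma. *)
Definition outcomes_F (X : nat -> vec) (sigma : seq vec -> nat) (Y : nat -> vec) : Prop :=
  is_block Y /\ (forall k, span X (Y k)) /\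
  (forall k j, Y k j != 0 -> (sigma (mkseq Y k) < j)%N).

(* Topology: R with its usual topology, E discrete, E^omega and omega^omega
   with product topologies. C closed in R x E^omega x omega^omega. *)
Definition closed_RxEwxNN (R : realType)
    (C : R -> (nat -> vec) -> (nat -> nat) -> Prop) : Prop :=
  forall t x y,
    (forall (eps : R) (n : nat), 0 < eps ->
       exists t' x' y', C t' x' y' /\ `|t' - t| < eps /\
         forall i, (i < n)%N -> x' i = x i /\ y' i = y i) ->
    C t x y.

Definition analytic_RxE (R : realType) (A : R -> (nat -> vec) -> Prop) : Prop :=
  exists C, closed_RxEwxNN C /\ forall t x, A t x <-> exists y, C t x y.

End Defs.

Definition nonempty_perfect (R : realType) (P : R -> Prop) : Prop :=
  (exists t, P t) /\
  (forall t, (forall eps : R, 0 < eps -> exists s, P s /\ `|s - t| < eps) -> P t) /\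
  (forall t, P t -> forall eps : R, 0 < eps -> exists s, P s /\ s != t /\ `|s - t| < eps).

(* Main.v *)
Require Import Defs.
From mathcomp Require Import all_boot all_order all_algebra reals.
From mathcomp Require Import boolp lra.
Import Order.TTheory GRing.Theory Num.Theory Defs.
Local Open Scope ring_scope.
Set Implicit Arguments. Unset Strict Implicit. Unset Printing Implicit Defensive.

(* Work over the Cantor space, embedded in the reals, and call (q, Y) a condition
   when q is a perfect set and Y is in H. A Sacks-style fusion in the first
   coordinate combined with the (p)-property in the second decides countably many
   questions at once, up to splitting q into finitely many relatively clopen
   pieces. Write A as the projection of a closed set C. Fusion decides, for every
   finite block sequence h and every finite initial segment w of a witness, whether
   I can uniformly (over q) prevent extensions of h from having a witness extending
   w. If I cannot do so at the empty position, then for each parameter t player II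
   moves from one bad position (h, w) to a bad position (h', w m) with h' longer
   than h; closedness of C shows that the resulting outcome lies in A_t.

   That II can reach the next bad position is an open game depending on t, and it
   is solved one move at a time by a parametrized pigeonhole principle: if D_t is
   a set of vectors depending openly on t, there is a condition (q, Y) such that
   either <Y> misses D_t for all t in q, or every block subspace of Y meets D_t for
   all t in q. To prove it, apply the unparametrized dichotomy to the set of those
   Y for which <Y> misses D_t for some t in q. If I avoids this set, the second
   alternative holds. If II plays into it then, H being strategic, some Y in H
   misses some D_t; if this happens below every condition, a second fusion, carried
   out along a play of the Gowers game, gives the first alternative. *)

(** * Block sequences and games *)


Section Blocks.
Variable F : countFieldType.
Local Notation E := (vec F).
Local Notation seqs := (nat -> vec F).
Implicit Types (X Y Z : seqs) (u v y z : E) (h : seq E).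

Definition nonzero v := exists k, v k != 0.
Definition above n v := forall k, v k != 0 -> (n < k)%N.

Lemma aboveW m n v : (m <= n)%N -> above n v -> above m v.
Proof. by move=> mn av k /av; apply: leq_ltn_trans. Qed.

Lemma spanE X v : span X v <-> exists N (c : nat -> F),
  (forall i, (N <= i)%N -> c i = 0) /\
  forall M, (N <= M)%N -> forall k, v k = \sum_(i < M) c i * X i k.
Proof.
split=> [[N [c [_ vE]]]|[N [c [_ vE]]]]; last first.
  by exists N, c; split=> // k; apply: vE.
exists N, (fun i => if (i < N)%N then c i else 0); split=> [i|M NM k].
  by rewrite leqNgt => /negbTE ->.
rewrite vE (big_ord_widen M (fun i => c i * X i k) NM) big_mkcond /=.
by apply: eq_bigr => i _; case: ifP; rewrite ?mul0r.
Qed.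

Lemma span_self X i : span X (X i).
Proof.
exists i.+1, (fun j => (j == i)%:R); split=> // k.
rewrite (bigD1 ord_max) //= eqxx mul1r big1 ?addr0 // => j.
by rewrite -val_eqE /= => /negbTE ->; rewrite mul0r.
Qed.

Lemma span_lin X a u v :
  span X u -> span X v -> span X (fun k => a * u k + v k).
Proof.
move=> /spanE[N [c [_ uE]]] /spanE[M [d [_ vE]]].
exists (maxn N M), (fun i => a * c i + d i); split=> // k.
rewrite (uE (maxn N M)) ?leq_maxl // (vE (maxn N M)) ?leq_maxr //.
rewrite mulr_sumr -big_split /=; apply: eq_bigr => i _.
by rewrite mulrDl mulrA.
Qed.

Lemma span0 X : span X (fun=> 0).
Proof. by exists 0, (fun=> 0); split=> // k; rewrite big_ord0. Qed.

Lemma span_sum X (w : nat -> E) (c : nat -> F) n :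
  (forall i, (i < n)%N -> span X (w i)) ->
  span X (fun k => \sum_(i < n) c i * w i k).
Proof.
elim: n => [|n IHn] Hw.
  by have -> : (fun k => \sum_(i < 0) c i * w i k) = (fun=> 0);
    [apply: funext => k; rewrite big_ord0|apply: span0].
have -> : (fun k => \sum_(i < n.+1) c i * w i k) =
   (fun k => c n * w n k + \sum_(i < n) c i * w i k).
  by apply: funext => k; rewrite big_ord_recr /= addrC.
by apply: span_lin; [apply: Hw|apply: IHn => i Hi; apply: Hw; apply: ltnW].
Qed.

Lemma preceq_of_terms Y X : (forall i, span X (Y i)) -> preceq Y X.
Proof.
move=> YX v [N [c [_ vE]]].
have -> : v = (fun k => \sum_(i < N) c i * Y i k) by apply: funext.
by apply: span_sum.
Qed.

Lemma block_lt X i j a b : is_block X -> (i < j)%N ->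
  X i a != 0 -> X j b != 0 -> (a < b)%N.
Proof.
move=> [Xn XS]; elim: j b => // j IHj b; rewrite ltnS leq_eqVlt.
case/orP=> [/eqP <-|ij Xi Xj]; first exact: XS.
by have [_ [d Xd]] := Xn j; apply: ltn_trans (IHj _ ij Xi Xd) (XS _ _ _ Xd Xj).
Qed.

Lemma block_index_le X i b : is_block X -> X i b != 0 -> (i <= b)%N.
Proof.
move=> bX; elim: i b => // i IHi b Xb.
have [_ [a Xa]] := (proj1 bX) i.
by apply: leq_ltn_trans (IHi _ Xa) (block_lt bX (ltnSn i) Xa Xb).
Qed.

Lemma block_coef X N (c : nat -> F) i k : is_block X -> (i < N)%N ->
  X i k != 0 -> \sum_(j < N) c j * X j k = c i * X i k.
Proof.
move=> bX iN Xik; rewrite (bigD1 (Ordinal iN)) //= big1 ?addr0 // => j.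
rewrite -val_eqE /= => ji; suff /eqP -> : X j k == 0 by rewrite mulr0.
apply/negPn/negP => Xjk.
case: (ltngtP j i) ji => // ji _.
  by have := block_lt bX ji Xjk Xik; rewrite ltnn.
by have := block_lt bX ji Xik Xjk; rewrite ltnn.
Qed.

Lemma finsupp_span X v : is_block X -> span X v -> finsupp v.
Proof.
move=> [Xn _] [N [c [_ vE]]].
have [b Hb] := choice (fun i => proj1 (Xn i)).
exists (\max_(i < N) b i) => k Hk; rewrite vE big1 // => i _.
by rewrite Hb ?mulr0 //; apply: leq_trans Hk; apply: leq_bigmax.
Qed.

(** Cuts by index instead of comparing supports with [n]. The support of [X i] starts at [i] or
    later, so what is left still spans only vectors above [n]. *)
Definition tail X n : seqs := fun i => X (n.+1 + i)%N.

Lemma block_tail X n : is_block X -> is_block (tail X n).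
Proof.
move=> [X1 X2]; split=> [i|i a b]; first exact: X1.
by rewrite /tail addnS; apply: X2.
Qed.

Lemma tail_preceq X n : preceq (tail X n) X.
Proof. by apply: preceq_of_terms => i; apply: span_self. Qed.

Lemma above_tail X n v : is_block X -> span (tail X n) v -> above n v.
Proof.
move=> bX [N [c [_ vE]]] k; apply: contra_neqT; rewrite -leqNgt => kn.
rewrite vE big1 // => i _; apply/eqP; rewrite mulf_eq0; apply/orP; right.
apply/negPn/negP => /(block_index_le bX).
by rewrite leqNgt ltnS (leq_trans kn) // leq_addr.
Qed.

(** Supports in a block sequence are disjoint, so every term with a nonzero coefficient shows its
    whole support in [v]; if [v] is above [n], so is that term. Almost inclusion can therefore be
    expressed through vectors alone, as in [ae_sub]. *)
Lemma span_sub_tailE Y n v : is_block Y ->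
  span_sub Y (tail_idx Y n) v <-> span Y v /\ above n v.
Proof.
move=> bY; split=> [[N [c [cP vE]]]|[[N [c [_ vE]]] av]].
  split; first by exists N, c.
  move=> k; apply: contra_neqT; rewrite -leqNgt => kn.
  rewrite vE big1 // => i _; have [Pi|/cP ->] := EM (tail_idx Y n i); last first.
    by rewrite mul0r.
  have [->|/Pi] := eqVneq (Y i k) 0; first by rewrite mulr0.
  by rewrite ltnNge kn.
exists N, (fun i => if (i < N)%N then c i else 0); split=> [i nPi|k].
  case: ifP => // iN; apply: contra_notP nPi => /eqP ci k Yik.
  by apply: av; rewrite vE (block_coef _ bY iN Yik) mulf_neq0.
by rewrite vE; apply: eq_bigr => i _; rewrite ltn_ord.
Qed.

Definition ae_sub Y X := exists n, forall v, span Y v -> above n v -> span X v.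

Lemma preceq_starE Y X : is_block Y -> preceq_star Y X <-> ae_sub Y X.
Proof.
move=> bY; split=> -[n Hn]; exists n => v.
  by move=> vY av; apply/Hn/span_sub_tailE.
by move=> /(span_sub_tailE _ _ bY)[]; apply: Hn.
Qed.

Lemma ae_refl X : ae_sub X X. Proof. by exists 0%N. Qed.

Lemma ae_preceq Y X : preceq Y X -> ae_sub Y X.
Proof. by move=> YX; exists 0%N => v /YX. Qed.

Lemma ae_trans Y X Z : ae_sub X Y -> ae_sub Y Z -> ae_sub X Z.
Proof.
move=> [n Hn] [m Hm]; exists (maxn n m) => v vX av; apply: Hm.
  by apply: Hn => //; apply: aboveW av; apply: leq_maxl.
by apply: aboveW av; apply: leq_maxr.
Qed.

Lemma ae_tail X n : is_block X -> ae_sub X (tail X n).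
Proof.
move=> bX; have [b Hb] := choice (fun i => proj1 ((proj1 bX) i)).
exists (\max_(i < n.+1) b i) => v /spanE[N [c [cN vE]]] av.
have c0 i : (i < n.+1)%N -> c i = 0.
  move=> ni; apply: contrapT => /eqP ci; have [_ [k Xk]] := (proj1 bX) i.
  have : v k != 0.
    rewrite (vE (maxn N i.+1)) ?leq_maxl // (block_coef _ bX _ Xk) ?mulf_neq0 //.
    exact: leq_maxr.
  move=> /av bk; move: Xk; rewrite Hb ?eqxx //.
  apply: leq_trans (ltnW bk).
  exact: (@leq_bigmax _ (fun i : 'I_n.+1 => b i) (Ordinal ni)).
exists N, (fun i => c (n.+1 + i)%N); split=> // k.
rewrite (vE (n.+1 + N)%N) ?leq_addl // big_split_ord /= big1 ?add0r //.
by move=> i _; rewrite c0 ?mul0r.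
Qed.

(* some_of X D says that II can play into D in one round of
   G[X], all_of X D that I can force II's next move in F[X] to be in D. Both are
   insensitive to replacing X by a tail. *)
Definition some_of X (D : E -> Prop) :=
  forall Z, is_block Z -> ae_sub Z X -> exists z, [/\ span Z z, nonzero z & D z].

Definition all_of X (D : E -> Prop) :=
  exists n, forall y, span X y -> nonzero y -> above n y -> D y.

Lemma some_of_ae Y X D : ae_sub Y X -> some_of X D -> some_of Y D.
Proof. by move=> YX sD Z bZ ZY; apply: sD => //; apply: ae_trans YX. Qed.

Lemma all_of_ae Y X D : ae_sub Y X -> all_of X D -> all_of Y D.
Proof.
move=> [n Hn] [m Hm]; exists (maxn n m) => y yY ny ay; apply: Hm => //.
  by apply: Hn => //; apply: aboveW ay; apply: leq_maxl.
by apply: aboveW ay; apply: leq_maxr.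
Qed.

Lemma some_of_sub X (D D' : E -> Prop) :
  (forall y, finsupp y -> D y -> D' y) -> some_of X D -> some_of X D'.
Proof.
move=> DD' sD Z bZ ZX; have [z [zZ nz Dz]] := sD Z bZ ZX.
by exists z; split=> //; apply: DD' => //; apply: finsupp_span zZ.
Qed.

Lemma all_of_sub X (D D' : E -> Prop) :
  (forall y, D y -> D' y) -> all_of X D -> all_of X D'.
Proof. by move=> DD' [n Hn]; exists n => y yX ny ay; apply/DD'/Hn. Qed.

Lemma some_of_above X D n :
  some_of X D -> some_of X (fun y => D y /\ above n y).
Proof.
move=> sD Z bZ ZX; have [z [zZ nz Dz]] := sD (tail Z n) (block_tail n bZ)
  (ae_trans (ae_preceq (@tail_preceq Z n)) ZX).
exists z; split=> //; first exact: tail_preceq zZ.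
by split=> //; apply: above_tail zZ.
Qed.

Lemma all_some X D : is_block X -> all_of X D -> some_of X D.
Proof.
move=> bX [n Hn] Z bZ [m Hm].
pose k := maxn n m; exists (tail Z k 0%N).
have s0 : span (tail Z k) (tail Z k 0%N) by apply: span_self.
have ak := above_tail bZ s0.
have nz := proj2 ((proj1 (block_tail k bZ)) 0%N).
split=> //; first exact: tail_preceq s0.
apply: Hn => //; last by apply: aboveW ak; apply: leq_maxl.
apply: Hm; first exact: tail_preceq s0.
by apply: aboveW ak; apply: leq_maxr.
Qed.

(** The game $F[X]$ resumed at position [h]: outcomes include [h], and only moves from index
    [size h] on are constrained. [A] is the set that I keeps out of. *)
Definition I_strategy X h (A : seqs -> Prop) (sigma : seq E -> nat) :=
  forall Y, is_block Y -> mkseq Y (size h) = h ->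
  (forall k, (size h <= k)%N -> span X (Y k) /\ above (sigma (mkseq Y k)) (Y k)) ->
  ~ A Y.

Definition Iwin X h A := exists sigma, I_strategy X h A sigma.

Lemma Iwin_choice (I : Type) X (h : I -> seq E) (A : I -> seqs -> Prop) :
  {L : I -> seq E -> nat &
    forall i, Iwin X (h i) (A i) -> I_strategy X (h i) (A i) (L i)}.
Proof.
apply: (@choice _ _ (fun i s => Iwin X (h i) (A i) ->
  I_strategy X (h i) (A i) s)) => i.
have [[s Hs]|nI] := EM (Iwin X (h i) (A i)); first by exists s.
by exists (fun=> 0%N).
Qed.

Lemma Iwin_sub X h (A A' : seqs -> Prop) :
  (forall Y, A' Y -> A Y) -> Iwin X h A -> Iwin X h A'.
Proof.
by move=> AA' [s Hs]; exists s => Y bY Yh HY /AA'; apply: Hs HY.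
Qed.

Lemma Iwin_ae Y X h A : ae_sub Y X -> Iwin X h A -> Iwin Y h A.
Proof.
move=> [n Hn] [s Hs]; exists (fun h => maxn n (s h)) => Z bZ Zh HZ.
apply: Hs => // k hk; have [ZY aZ] := HZ k hk; split.
  by apply: Hn => //; apply: aboveW aZ; apply: leq_maxl.
by apply: aboveW aZ; apply: leq_maxr.
Qed.

Lemma take_mkseq T (Y : nat -> T) k m :
  (k <= m)%N -> take k (mkseq Y m) = mkseq Y k.
Proof. by move=> km; rewrite -map_take take_iota (minn_idPl km). Qed.

(* Player I follows infinitely many strategies at once by taking up only
   finitely many of them at each position. *)
Lemma follow_many (s0 : seq E -> nat) (N : seq E -> nat)
    (L : seq E -> nat -> seq E -> nat) : exists s : seq E -> nat,
  forall Y m v, above (s (mkseq Y m)) v ->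
    above (s0 (mkseq Y m)) v /\
    forall k i, (k <= m)%N -> (i < N (mkseq Y k))%N ->
      above (L (mkseq Y k) i (mkseq Y m)) v.
Proof.
exists (fun h => maxn (s0 h) (\max_(k < (size h).+1)
   \max_(i < N (take k h)) L (take k h) i h)) => Y m v av.
split=> [|k i km iN]; first by apply: aboveW av; apply: leq_maxl.
apply: aboveW av; rewrite leq_max; apply/orP; right.
have km' : (k < (size (mkseq Y m)).+1)%N by rewrite size_mkseq.
have iN' : (i < N (take k (mkseq Y m)))%N by rewrite take_mkseq.
apply: leq_trans (leq_bigmax (Ordinal km')) => /=.
by apply: leq_trans (leq_bigmax (Ordinal iN')); rewrite /= take_mkseq.
Qed.

Section Run.
Variables (St : Type) (X : seqs) (good : St -> Prop).
Variable (step : St -> E -> St -> Prop).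

(** II carries a state along and folds a choice function over I's moves. Beside the state it
    remembers a bound on the support of its last vector, which makes the outcome a block
    sequence. *)
Lemma II_strategy_of_step s0 : good s0 ->
  (forall s, good s -> some_of X (fun y => exists s', step s y s' /\ good s')) ->
  exists alpha, II_strategy_G X alpha /\
    forall Ys, I_play_G X Ys -> exists S : nat -> St, S 0%N = s0 /\
      forall k, good (S k) /\ step (S k) (outcome_G alpha Ys k) (S k.+1).
Proof.
move=> g0 Hs.
have [ch Hch] : {ch : (St * nat) * seqs -> E * (St * nat) & forall t,
   good t.1.1 -> is_block t.2 -> preceq t.2 X ->
   [/\ span t.2 (ch t).1 /\ nonzero (ch t).1, above t.1.2 (ch t).1,
       forall k, (ch t).1 k != 0 -> (k <= (ch t).2.2)%N,
       step t.1.1 (ch t).1 (ch t).2.1 & good (ch t).2.1]}.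
  apply: (@choice _ _ (fun (t : (St * nat) * seqs) (r : E * (St * nat)) =>
    good t.1.1 -> is_block t.2 -> preceq t.2 X ->
    [/\ span t.2 r.1 /\ nonzero r.1, above t.1.2 r.1,
        forall k, r.1 k != 0 -> (k <= r.2.2)%N,
        step t.1.1 r.1 r.2.1 & good r.2.1])) => -[[s n] Z] /=.
  have [gs|ngs] := EM (good s); last by exists (fun=> 0, (s0, 0%N)).
  have [[bZ ZX]|nZ] := EM (is_block Z /\ preceq Z X); last first.
    by exists (fun=> 0, (s0, 0%N)) => _ bZ ZX; case: nZ.
  have [z [zZ nz [[s' [st gs']] az]]] :=
    some_of_above n (Hs s gs) bZ (ae_preceq ZX).
  have [N HN] := finsupp_span bZ zZ.
  exists (z, (s', N)) => _ _ _; split=> //= k zk.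
  by rewrite leqNgt; apply/negP => /ltnW /HN; apply/eqP.
pose f (r : E * (St * nat)) Z := ch (r.2, Z).
pose fold l := foldl f (fun=> 0, (s0, 0%N)) l.
have foldS Ys k : fold (mkseq Ys k.+1) = ch ((fold (mkseq Ys k)).2, Ys k).
  by rewrite /fold mkseqS foldl_rcons.
pose alpha l := (fold l).1.
have main Ys : I_play_G X Ys -> forall k,
  good (fold (mkseq Ys k)).2.1.
  by move=> HY; elim=> // k IHk; rewrite foldS; have [bY YX] := HY k;
    case: (Hch ((fold (mkseq Ys k)).2, Ys k) IHk bY YX).
have mainS Ys (HY : I_play_G X Ys) k :=
  Hch ((fold (mkseq Ys k)).2, Ys k) (main Ys HY k) (proj1 (HY k)) (proj2 (HY k)).
exists alpha; split=> [Ys HY|Ys HY].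
  have out k : outcome_G alpha Ys k = (ch ((fold (mkseq Ys k)).2, Ys k)).1.
    by rewrite /outcome_G /alpha foldS.
  split=> [|k]; last by rewrite out; case: (mainS Ys HY k) => -[].
  split=> [k|k i j].
    rewrite out; case: (mainS Ys HY k) => -[spY nY] _ _ _ _; split=> //.
    exact: finsupp_span (proj1 (HY k)) spY.
  rewrite !out foldS; case: (mainS Ys HY k) => _ _ Hhi _ _ /Hhi Hi.
  case: (mainS Ys HY k.+1) => _; rewrite foldS => Hlo _ _ _ /Hlo /=.
  exact: leq_ltn_trans.
exists (fun k => (fold (mkseq Ys k)).2.1); split=> // k; split; first exact: main.
by rewrite /outcome_G /alpha foldS; case: (mainS Ys HY k).
Qed.

End Run.

(** Comes from a play in which I always offers [Z] itself and II, whose state is the history, picks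
    vectors above what [sigma] demands. *)
Lemma thin_block Z X (sigma : seq E -> nat) : is_block Z -> ae_sub Z X ->
  exists Z', [/\ is_block Z', preceq Z' Z & forall k,
    span X (Z' k) /\ above (sigma (mkseq Z' k)) (Z' k)].
Proof.
move=> bZ [n Hn].
have [||alpha [Ha1 Ha2]] := @II_strategy_of_step (seq E) Z (fun=> True)
  (fun h y h' => h' = rcons h y /\ above (maxn n (sigma h)) y) [::].
- by [].
- move=> h _ W bW WZ.
  have [z [zW nz [_ az]]] := some_of_above (maxn n (sigma h))
    (@all_some Z (fun=> True) bZ (ex_intro _ 0%N (fun _ _ _ _ => I))) bW WZ.
  by exists z; split=> //; exists (rcons h z).
have HYs : I_play_G Z (fun=> Z) by move=> k; split.
have [b sp] := Ha1 _ HYs; have [S [S0 HS]] := Ha2 _ HYs.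
exists (outcome_G alpha (fun=> Z)); set Y := outcome_G _ _.
have SE k : S k = mkseq Y k.
  by elim: k => [//|k IHk]; rewrite mkseqS -IHk; case: (HS k) => _ [].
split=> // [|k]; first exact: preceq_of_terms.
case: (HS k) => _ [_]; rewrite -/Y SE => ak; split.
  by apply: Hn; [apply: sp|apply: aboveW ak; apply: leq_maxl].
by apply: aboveW ak; apply: leq_maxr.
Qed.

Lemma Iwin_some_of X A : Iwin X [::] A -> forall Z, is_block Z -> ae_sub Z X ->
  exists Z', [/\ is_block Z', preceq Z' Z & ~ A Z'].
Proof.
move=> [s Hs] Z bZ ZX; have [Z' [bZ' Z'Z HZ']] := thin_block s bZ ZX.
by exists Z'; split=> //; apply: Hs.
Qed.

End Blocks.

(** * Perfect sets and fusion *)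


Lemma dependent_choice_nat (A : Type) (P : nat -> A -> Prop)
    (Q : nat -> A -> A -> Prop) a0 : P 0%N a0 ->
  (forall n a, P n a -> exists b, P n.+1 b /\ Q n a b) ->
  exists f : nat -> A, f 0%N = a0 /\ forall n, P n (f n) /\ Q n (f n) (f n.+1).
Proof.
move=> P0 PS.
have [g Hg] : {g : nat * A -> A & forall x, P x.1 x.2 ->
    P x.1.+1 (g x) /\ Q x.1 x.2 (g x)}.
  apply: (@choice _ _ (fun (x : nat * A) b =>
    P x.1 x.2 -> P x.1.+1 b /\ Q x.1 x.2 b)) => -[n a] /=.
  by have [/PS [b Hb]|nP] := EM (P n a); [exists b|exists a0].
pose f := fix f n := if n is m.+1 then g (m, f m) else a0.
have Pf n : P n (f n) by elim: n => // n /(Hg (n, _))[].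
by exists f; split=> // n; split; [|case: (Hg (n, f n) (Pf n))].
Qed.

Section Cantor.
Implicit Types (t : nat -> bool) (p q : (nat -> bool) -> Prop) (k n : nat).

Definition agree k t t' := forall i, (i < k)%N -> t i = t' i.

Lemma agree_sym k t t' : agree k t t' -> agree k t' t.
Proof. by move=> a i /a. Qed.

Lemma agree_trans k t t' t'' : agree k t t' -> agree k t' t'' -> agree k t t''.
Proof. by move=> a b i ik; rewrite a ?b. Qed.

Lemma agreeW m k t t' : (m <= k)%N -> agree k t t' -> agree m t t'.
Proof. by move=> mk a i im; apply: a; apply: leq_trans mk. Qed.

Lemma agree_mkseq k t : agree k (nth false (mkseq t k)) t.
Proof. by move=> i ik; rewrite nth_mkseq. Qed.

Lemma eq_mkseq_agree k t t' : agree k t t' -> mkseq t k = mkseq t' k.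
Proof.
move=> a; apply: (@eq_from_nth _ false); rewrite ?size_mkseq // => i ik.
by rewrite !nth_mkseq // a.
Qed.

Definition sub p q := forall t, p t -> q t.
Definition piece q k t := fun t' => q t' /\ agree k t t'.
Definition closedT q := forall t,
  (forall k, exists t', q t' /\ agree k t t') -> q t.
Definition perf q := [/\ exists t, q t, closedT q &
  forall t k, q t -> exists t', [/\ q t', agree k t t' & t' <> t]].

Lemma sub_trans p q r : sub p q -> sub q r -> sub p r.
Proof. by move=> pq qr t /pq /qr. Qed.

Lemma piece_sub q k t : sub (piece q k t) q. Proof. by move=> t' []. Qed.

Lemma piece_mem q k t : q t -> piece q k t t. Proof. by []. Qed.

Lemma piece_le q k k' t t' : (k <= k')%N -> agree k t t' ->
  sub (piece q k' t') (piece q k t).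
Proof.
move=> kk' a u [qu a']; split=> //.
by apply: agree_trans a (agreeW kk' a').
Qed.

Lemma piece_mono p q k t : sub p q -> sub (piece p k t) (piece q k t).
Proof. by move=> pq t' [/pq]. Qed.

Lemma perf_piece q k t : perf q -> (exists t', piece q k t t') ->
  perf (piece q k t).
Proof.
move=> [_ cq iq] ne; split=> // [u Hu|u m [qu au]].
  split; first by apply: cq => m; have [t' [[qt' _] a]] := Hu m; exists t'.
  have [t' [[qt' at'] a]] := Hu k.
  by apply: agree_trans at' (agree_sym a).
have [t' [qt' a ne']] := iq u (maxn k m) qu; exists t'; split=> //.
  split=> //; apply: agree_trans au _; apply: agreeW a; exact: leq_maxl.
by apply: agreeW a; apply: leq_maxr.
Qed.

Lemma perf_piece_mem q k t : perf q -> q t -> perf (piece q k t).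
Proof. by move=> pq qt; apply: perf_piece => //; exists t. Qed.

Definition strings k : seq (seq bool) := map val (enum {: k.-tuple bool}).

Lemma mem_strings k t : mkseq t k \in strings k.
Proof.
have sz : size (mkseq t k) == k by rewrite size_mkseq.
by apply/mapP; exists (Tuple sz); rewrite ?mem_enum.
Qed.

(** Only the first [k] bits matter, so a maximum over the finitely many strings of length [k] serves
    all [t] at once. *)
Lemma uniform_bound k q (P : (nat -> bool) -> nat -> Prop) :
  (forall t t' n, agree k t t' -> P t n -> P t' n) ->
  (forall t m n, (m <= n)%N -> P t m -> P t n) ->
  (forall t, q t -> exists n, P t n) -> exists n, forall t, q t -> P t n.
Proof.
move=> Pk Pmono Pq.
have [b Hb] : {b : seq bool -> nat & forall c t, q t -> c = mkseq t k -> P t (b c)}.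
  apply: (@choice _ _ (fun c n => forall t, q t -> c = mkseq t k -> P t n)) => c.
  have [[t [qt ct]]|nt] := EM (exists t, q t /\ c = mkseq t k); last first.
    by exists 0%N => t qt ct; case: nt; exists t.
  have [n Pn] := Pq t qt; exists n => t' _ ct'; apply: Pk Pn.
  apply: agree_trans (agree_sym (@agree_mkseq k t)) _.
  by rewrite -ct ct'; apply: agree_mkseq.
exists (\max_(c <- strings k) b c) => t qt.
apply: Pmono (Hb _ t qt erefl).
exact: (@leq_bigmax_seq _ (strings k) xpredT b _ (mem_strings k t)).
Qed.

Lemma perfT : perf (fun=> True).
Proof.
split=> //; first by exists (fun=> true).
move=> t k _; exists (fun i => if (i < k)%N then t i else ~~ t i); split=> //.
  by move=> i ->.
by move=> /(congr1 (fun u => u k)); rewrite ltnn; case: (t k).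
Qed.

Lemma neq_index t t' : t <> t' -> exists i, t i <> t' i.
Proof.
move=> ne; apply: contrapT => H; apply: ne; apply: funext => i.
by apply: contrapT => ne; apply: H; exists i.
Qed.

(** * Limits of fusion sequences of perfect sets *)

Section Scheme.
Variables (q : nat -> (nat -> bool) -> Prop) (l : nat -> nat).
Hypotheses (q0 : exists t, q 0%N t) (qC : forall n, closedT (q n))
  (qS : forall n, sub (q n.+1) (q n)) (lS : forall n, (l n < l n.+1)%N)
  (q_ext : forall n t, q n t -> exists t', q n.+1 t' /\ agree (l n) t t')
  (q_split : forall n t, q n.+1 t ->
     exists t', [/\ q n.+1 t', agree (l n) t t' & ~ agree (l n.+1) t t']).

Lemma level_ge n : (n <= l n)%N.
Proof. by elim: n => // n IHn; apply: leq_ltn_trans IHn (lS n). Qed.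

Lemma level_homo m n : (m <= n)%N -> (l m <= l n)%N.
Proof.
elim: n => [|n IHn]; first by rewrite leqn0 => /eqP ->.
rewrite leq_eqVlt => /orP[/eqP -> //|mn].
exact: leq_trans (IHn mn) (ltnW (lS n)).
Qed.

Lemma scheme_sub m n : (m <= n)%N -> sub (q n) (q m).
Proof.
elim: n => [|n IHn]; first by rewrite leqn0 => /eqP ->.
rewrite leq_eqVlt => /orP[/eqP -> //|mn].
by apply: sub_trans (@qS n) (IHn mn).
Qed.

Lemma scheme_extend n t : q n t ->
  exists t', (forall m, q m t') /\ agree (l n) t t'.
Proof.
move=> qt.
have [||u [u0 Hu]] := @dependent_choice_nat _ (fun m t => q (n + m)%N t)
  (fun m t t' => agree (l (n + m)%N) t t') t.
- by rewrite addn0.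
- by move=> m a /q_ext; rewrite addnS.
have stable m m' : (m <= m')%N -> agree (l (n + m)%N) (u m) (u m').
  elim: m' => [|m' IHm]; first by rewrite leqn0 => /eqP ->.
  rewrite leq_eqVlt => /orP[/eqP -> //|mm'].
  apply: agree_trans (IHm mm') _; have [_] := Hu m'; apply: agreeW.
  by apply: level_homo; rewrite leq_add2l.
(* Diagonal limit: bit [i] is already final in [u i.+1], whose stable length exceeds [i] by
   [level_ge]. *)
pose s i := u i.+1 i.
have us m : agree (l (n + m)%N) (u m) s.
  move=> i ik; rewrite /s (stable _ _ (leq_maxl m i.+1)) //.
  rewrite (stable _ _ (leq_maxr m i.+1)) //.
  by apply: leq_trans (level_ge _); rewrite addnS ltnS leq_addl.
exists s; split=> [m|]; last by have := us 0%N; rewrite addn0 u0.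
apply: qC => k; exists (u (m + k)%N); split.
  by apply: scheme_sub (proj1 (Hu (m + k)%N)); rewrite addnCA leq_addr.
apply: agree_sym; apply: agreeW (us _).
by apply: leq_trans (level_ge _); rewrite addnA leq_addl.
Qed.

(** A point of stage [k.+1] that parts from [t] below [l k.+1] extends into the intersection without
    changing those bits, so splitting survives in the limit. *)
Lemma perf_scheme : perf (fun t => forall n, q n t).
Proof.
split.
- by have [t /scheme_extend[t' [Ht' _]]] := q0; exists t'.
- move=> t Ht n; apply: qC => k; have [t' [qt' a]] := Ht k.
  by exists t'; split=> //; apply: qt'.
move=> t k Ht; have [t' [qt' a na]] := q_split (Ht k.+1).
have [s [Hs as_]] := scheme_extend qt'.
exists s; split=> //.
  apply: agreeW (level_ge k) _; apply: agree_trans a _.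
  by apply: agreeW as_; apply: ltnW.
by move=> st; apply: na; apply: agree_sym; rewrite -st.
Qed.

End Scheme.

End Cantor.

(** * Fusion and diagonalization for (p)-families; the dichotomy from fullness *)

Section Family.
Variables (F : countFieldType).
Local Notation seqs := (nat -> vec F).
Local Notation E := (vec F).
Variable (H : seqs -> Prop).
Hypotheses (famH : is_family H) (pH : p_family H).
Implicit Types (X Y : seqs) (p q : (nat -> bool) -> Prop).

Lemma H_block X : H X -> is_block X.
Proof. by case: famH => + _; apply. Qed.

Lemma H_tail X n : H X -> H (tail X n).
Proof.
move=> HX; have bX := H_block HX; case: famH => _ [_ Hup].
apply: Hup HX (block_tail n bX) _.
by apply/preceq_starE=> //; apply: ae_tail.
Qed.

Lemma H_refine Y X : H Y -> ae_sub Y X ->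
  exists Y', [/\ H Y', preceq Y' X & preceq Y' Y].
Proof.
move=> HY [n Hn]; exists (tail Y n); split; first exact: H_tail.
  move=> v vY; apply: Hn; first exact: tail_preceq vY.
  exact: above_tail (H_block HY) vY.
exact: tail_preceq.
Qed.

(** The (p)-property speaks of genuinely decreasing sequences. Replacing each [Xs n] by a suitable
    tail, harmless up to [ae_sub], turns an almost decreasing sequence into such a one. *)
Lemma H_pseudointersection (Xs : nat -> seqs) : (forall n, H (Xs n)) ->
  (forall n, ae_sub (Xs n.+1) (Xs n)) ->
  exists X, H X /\ forall n, ae_sub X (Xs n).
Proof.
move=> HX Xdec.
have [||f [f0 Hf]] := @dependent_choice_nat seqs
  (fun n Y => [/\ H Y, ae_sub (Xs n) Y & preceq Y (Xs n)])
  (fun n Y Y' => preceq Y' Y) (Xs 0%N).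
- by split=> //; apply: ae_refl.
- move=> n Y [HY XY YX].
  have [m Hm] := ae_trans (Xdec n) XY; exists (tail (Xs n.+1) m); split.
    split; [exact: H_tail|apply: ae_tail; exact: H_block|exact: tail_preceq].
  move=> v vY; apply: Hm; first exact: tail_preceq vY.
  by apply: above_tail vY; exact: H_block.
have Hfn n : H (f n) by have [[]] := Hf n.
have [X [HXX XXs]] := pH Hfn (fun n => proj2 (Hf n)).
exists X; split=> // n; have [[_ _ /ae_preceq fX] _] := Hf n.
by apply: ae_trans fX; apply/preceq_starE => //; apply: H_block.
Qed.

Section Fusion.
Variables (Phi : nat -> ((nat -> bool) -> Prop) -> seqs -> Prop).
Variables (p : (nat -> bool) -> Prop) (X : seqs).
Hypothesis Phi_her : forall j q q' Y Y', sub q' q -> perf q' -> H Y' ->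
  ae_sub Y' Y -> Phi j q Y -> Phi j q' Y'.
Hypothesis Phi_dense : forall j q Y, perf q -> sub q p -> H Y -> ae_sub Y X ->
  exists q' Y', [/\ perf q', sub q' q, H Y', ae_sub Y' Y & Phi j q' Y'].

(** The strings are treated one at a time; [Y] shrinks at each, and heredity preserves [Phi j] at
    the earlier ones. *)
Lemma fusion_list j q k Y (l : seq (seq bool)) :
  perf q -> sub q p -> H Y -> ae_sub Y X ->
  exists (Q : seq bool -> (nat -> bool) -> Prop) Y', [/\ H Y', ae_sub Y' Y &
    forall c, c \in l -> (exists t, piece q k (nth false c) t) ->
    [/\ perf (Q c), sub (Q c) (piece q k (nth false c)) & Phi j (Q c) Y']].
Proof.
move=> pq qp HY YX; elim: l => [|c l [Q [Y1 [HY1 Y1Y HQ]]]].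
  by exists (fun=> q), Y; split=> //; apply: ae_refl.
have [ne|ne] := EM (exists t, piece q k (nth false c) t); last first.
  exists Q, Y1; split=> // d; rewrite inE => /orP[/eqP -> //|]; exact: HQ.
have [q' [Y2 [pq' q'q HY2 Y2Y1 Phi2]]] : exists q' Y',
   [/\ perf q', sub q' (piece q k (nth false c)), H Y', ae_sub Y' Y1 & Phi j q' Y'].
  apply: Phi_dense => //; first exact: perf_piece.
    exact: sub_trans (@piece_sub _ _ _) qp.
  exact: ae_trans Y1Y YX.
exists (fun d => if d == c then q' else Q d), Y2; split=> //.
  exact: ae_trans Y1Y.
move=> d; rewrite inE; case: eqP => [-> //|_ /=] dl ned.
have [pQ Qq Phi1] := HQ d dl ned; split=> //.
by apply: Phi_her Phi1.
Qed.

(** Every nonempty piece of length [k] is thinned to a perfect set on which [Phi j] holds, and [q']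
    is the union of these finitely many sets. *)
Lemma fusion_step j q k Y : perf q -> sub q p -> H Y -> ae_sub Y X ->
  exists q' k' Y', [/\ [/\ perf q', sub q' q, H Y', ae_sub Y' Y & (k < k')%N],
    forall t, q t -> exists t', q' t' /\ agree k t t',
    forall t, q' t -> exists t', [/\ q' t', agree k t t' & ~ agree k' t t'] &
    forall t, q' t -> Phi j (piece q' k t) Y'].
Proof.
move=> pq qp HY YX.
pose l := strings k; have memL := mem_strings k.
have [Q [Y' [HY' Y'Y HQ]]] := fusion_list j k l pq qp HY YX.
pose q' := fun t => q t /\ Q (mkseq t k) t.
have HQt t : q t -> [/\ perf (Q (mkseq t k)),
    forall t', Q (mkseq t k) t' -> q' t' /\ agree k t t' &
    Phi j (Q (mkseq t k)) Y'].
  move=> qt; have [|pQ Qq PQ] := HQ _ (memL t : _ \in l).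
    by exists t; split=> //; apply: agree_mkseq.
  split=> // t' Qt'; have [qt' a] := Qq _ Qt'.
  have a' : agree k t t' by apply: agree_trans (agree_sym (@agree_mkseq _ _)) a.
  by split=> //; split=> //; rewrite -(eq_mkseq_agree a').
have [i Hi] : {i : seq bool -> nat & forall c t, c = mkseq t k -> q t ->
    exists t1 t2, [/\ Q c t1, Q c t2 & t1 (i c) <> t2 (i c)]}.
  apply: (@choice _ _ (fun c i => forall t, c = mkseq t k -> q t ->
    exists t1 t2, [/\ Q c t1, Q c t2 & t1 i <> t2 i])) => c.
  have [[t [-> qt]]|nt] := EM (exists t, c = mkseq t k /\ q t); last first.
    by exists 0%N => t ct qt; case: nt; exists t.
  have [[[t1 Qt1] _ Qi] _ _] := HQt t qt.
  have [t2 [Qt2 _ /neq_index[i Hi]]] := Qi t1 0%N Qt1.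
  by exists i => _ _ _; exists t2, t1.
(* [k'] lies beyond an index at which each thinned piece splits, as [perf_scheme] requires. *)
pose k' := (maxn k (\max_(c <- l) i c)).+1.
exists q', k', Y'; split.
- split=> //; last by rewrite ltnS leq_maxl.
  + split.
    * have [[t qt] _ _] := pq; have [[[t' Qt'] _ _] HQ' _] := HQt t qt.
      by exists t'; have [] := HQ' _ Qt'.
    * move=> t Ht.
      have qt : q t.
        by case: pq => _ cq _; apply: cq => m; have [t' [[? _] ?]] := Ht m; exists t'.
      split=> //; have [[_ cQ _] _ _] := HQt t qt; apply: cQ => m.
      have [t' [[qt' Qt'] a]] := Ht (maxn k m); exists t'.
      rewrite (eq_mkseq_agree (agreeW (leq_maxl _ _) a)); split=> //.
      by apply: agreeW a; apply: leq_maxr.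
    * move=> t m [qt Qt]; have [[_ _ iQ] HQ' _] := HQt t qt.
      have [t' [Qt' a ne]] := iQ t m Qt; exists t'; split=> //.
      by have [] := HQ' _ Qt'.
  + by move=> t [].
- move=> t qt; have [[[t' Qt'] _ _] HQ' _] := HQt t qt.
  by exists t'; apply: HQ'.
- move=> t [qt Qt]; have [_ HQ' _] := HQt t qt.
  have [t1 [t2 [Qt1 Qt2 ne]]] := Hi _ t erefl qt.
  have ik : (i (mkseq t k) < k')%N.
    by rewrite ltnS leq_max leq_bigmax_seq // orbT.
  have [e1|n1] := EM (t (i (mkseq t k)) = t1 (i (mkseq t k))).
    exists t2; have [? ?] := HQ' _ Qt2; split=> // a; apply: ne.
    by rewrite -e1; apply: a.
  by exists t1; have [? ?] := HQ' _ Qt1; split=> // a; apply: n1; apply: a.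
move=> t [qt Qt]; have [pQ HQ' PQ] := HQt t qt.
apply: (Phi_her _ _ HY' (@ae_refl _ _) PQ).
  by move=> t' [[qt' Qt'] a]; rewrite (eq_mkseq_agree a).
split.
- by exists t.
- move=> u Hu; have [_ cQ _] := pQ.
  suff /HQ' : Q (mkseq t k) u by [].
  apply: cQ => m; have [t' [[[_ Qt'] a] b]] := Hu m; exists t'.
  by rewrite (eq_mkseq_agree a).
move=> u m [[qu Qu] a]; have [_ _ iQ] := pQ.
have Qu' : Q (mkseq t k) u by rewrite (eq_mkseq_agree a).
have [t' [Qt' a' ne]] := iQ u m Qu'; exists t'; split=> //.
exact: HQ'.
Qed.

(** Iterates [fusion_step]; the limit is taken by [perf_scheme] in the first coordinate and by a
    pseudointersection in the second. [Phi j], obtained at stage [j.+1] on pieces of the length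
    reached at stage [j], passes to the limit by heredity. *)
Lemma fusion_nat : perf p -> H X -> exists q Y,
  [/\ perf q, sub q p, H Y, ae_sub Y X &
   forall j, exists k, forall t, q t -> Phi j (piece q k t) Y].
Proof.
move=> pp HX.
have [||f [f0 Hf]] := @dependent_choice_nat
  (((nat -> bool) -> Prop) * nat * seqs)
  (fun n x => [/\ perf x.1.1, sub x.1.1 p, H x.2 & ae_sub x.2 X])
  (fun n x y => [/\ [/\ perf y.1.1, sub y.1.1 x.1.1, H y.2, ae_sub y.2 x.2
    & (x.1.2 < y.1.2)%N],
    forall t, x.1.1 t -> exists t', y.1.1 t' /\ agree x.1.2 t t',
    forall t, y.1.1 t -> exists t',
      [/\ y.1.1 t', agree x.1.2 t t' & ~ agree y.1.2 t t'] &
    forall t, y.1.1 t -> Phi n (piece y.1.1 x.1.2 t) y.2])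
  (p, 0%N, X).
- by split=> //; apply: ae_refl.
- move=> n [[q k] Y] /= [pq qp HY YX].
  have [q' [k' [Y' Hs]]] := fusion_step n k pq qp HY YX.
  exists (q', k', Y'); split=> //=; have [[pq' q'q HY' Y'Y _] _ _ _] := Hs.
  by split=> //; [exact: sub_trans q'q qp|exact: ae_trans Y'Y YX].
have [||Y [HY YY]] := @H_pseudointersection (fun n => (f n).2).
- by move=> n; have [[]] := Hf n.
- by move=> n; have [_ [[]]] := Hf n.
have pqq : perf (fun t => forall n, (f n).1.1 t).
  apply: (@perf_scheme (fun n => (f n).1.1) (fun n => (f n).1.2)).
  - by rewrite f0; case: pp.
  - by move=> n; have [[[]]] := Hf n.
  - by move=> n; have [_ [[]]] := Hf n.
  - by move=> n; have [_ [[]]] := Hf n.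
  - by move=> n; have [_ []] := Hf n.
  - by move=> n; have [_ []] := Hf n.
exists (fun t => forall n, (f n).1.1 t), Y; split=> //.
- by move=> t /(_ 0%N); rewrite f0.
- by have := YY 0%N; rewrite f0.
move=> j; exists (f j).1.2 => t Ht.
have [_ [_ _ _ /(_ t (Ht j.+1)) HPhi]] := Hf j.
apply: (Phi_her _ _ HY (YY j.+1) HPhi); last exact: perf_piece_mem.
by move=> t' [/(_ j.+1) ? ?].
Qed.

End Fusion.

(** [vec F] contains all functions and is uncountable; only positions made of finitely supported
    vectors can be enumerated for a fusion. *)
Definition finsupps (h : seq E) := forall i, finsupp (nth (fun=> 0) h i).

Lemma finsupps_rcons h (y : E) : finsupps h -> finsupp y -> finsupps (rcons h y).
Proof.
move=> fh fy i; rewrite nth_rcons; case: ifP => // _; case: ifP => // _.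
by exists 0%N.
Qed.

Lemma finsupps_nil : finsupps [::].
Proof. by move=> i; rewrite nth_nil; exists 0%N. Qed.

Lemma finsupps_mkseq (Y : seqs) k : is_block Y -> finsupps (mkseq Y k).
Proof.
move=> [bY _] i; case: (ltnP i k) => ik; first by rewrite nth_mkseq //; case: (bY i).
by rewrite nth_default ?size_mkseq //; exists 0%N.
Qed.

Lemma finsupps_enum (K : countType) : exists e : nat -> option (seq E * K),
  forall h x, finsupps h -> exists j, e j = Some (h, x).
Proof.
exists (fun j => omap (fun r : seq (seq F) * K =>
  (map (fun c i => nth 0 c i) r.1, r.2)) (unpickle j)) => h x fh.
suff [l <-] : exists l : seq (seq F), map (fun c i => nth 0 c i) l = h.
  by exists (pickle (l, x)); rewrite pickleK.
elim: h fh => [|v h IHh] fh; first by exists [::].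
have [l lh] := IHh (fun i => fh i.+1); have [N HN] : finsupp v := fh 0%N.
exists (mkseq v N :: l); rewrite /= lh; congr (_ :: _); apply: funext => i.
case: (ltnP i N) => iN; first by rewrite nth_mkseq.
by rewrite nth_default ?size_mkseq // HN.
Qed.

Lemma fusion (K : countType)
  (Phi : seq E -> K -> ((nat -> bool) -> Prop) -> seqs -> Prop) p X :
  perf p -> H X ->
  (forall h x q q' Y Y', sub q' q -> perf q' -> H Y' ->
    ae_sub Y' Y -> Phi h x q Y -> Phi h x q' Y') ->
  (forall h x q Y, finsupps h -> perf q -> sub q p -> H Y -> ae_sub Y X ->
    exists q' Y', [/\ perf q', sub q' q, H Y', ae_sub Y' Y & Phi h x q' Y']) ->
  exists q Y, [/\ perf q, sub q p, H Y, ae_sub Y X & forall h x, finsupps h ->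
    exists k, forall t, q t -> Phi h x (piece q k t) Y].
Proof.
move=> pp HX her dense; have [e He] := finsupps_enum K.
have [||q [Y [pq qp HY YX HPhi]]] := @fusion_nat
  (fun j q Y => if e j is Some r then finsupps r.1 -> Phi r.1 r.2 q Y else True)
  p X _ _ pp HX.
- move=> j q q' Y Y' q'q pq' HY' Y'Y; case: (e j) => // -[h x] Hr /Hr.
  exact: her.
- move=> j q Y pq qp HY YX; case: (e j) => [[h x] /=|]; last first.
    by exists q, Y; split=> //; apply: ae_refl.
  have [fh|nf] := EM (finsupps h); last first.
    by exists q, Y; split=> //; apply: ae_refl.
  have [q' [Y' [? ? ? ? ?]]] := dense h x q Y fh pq qp HY YX.
  by exists q', Y'.
exists q, Y; split=> // h x fh; have [j ej] := He h x fh.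
by have [k Hk] := HPhi j; exists k => t /Hk; rewrite ej; apply.
Qed.

(** Fusion for requirements that ignore the first coordinate; one point of the limit set suffices to
    read them off. *)
Lemma diagonalize (K : countType) (Psi : seq E -> K -> seqs -> Prop) X : H X ->
  (forall h x Y Y', H Y' -> ae_sub Y' Y -> Psi h x Y -> Psi h x Y') ->
  (forall h x Y, finsupps h -> H Y -> ae_sub Y X ->
    exists Y', [/\ H Y', ae_sub Y' Y & Psi h x Y']) ->
  exists Y, [/\ H Y, ae_sub Y X & forall h x, finsupps h -> Psi h x Y].
Proof.
move=> HX her dense.
have [||q [Y [[[t qt] _ _] _ HY YX HPsi]]] :=
  @fusion K (fun h x _ Y => Psi h x Y) (fun=> True) X perfT HX.
- by move=> h x q q' Y Y' _ _ HY' Y'Y; apply: her.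
- move=> h x q Y fh pq _ HY YX; have [Y' [HY' Y'Y HP]] := dense h x Y fh HY YX.
  by exists q, Y'; split=> // t.
by exists Y; split=> // h x fh; have [k /(_ t qt)] := HPsi h x fh.
Qed.

Hypothesis fullH : full H.

(** Fullness is applied to [D'], which admits the zero vector because every span contains it. If
    [D'] is not dense below [X], some [Y] in [H] has no block subspace inside [D'], so each of its
    block subspaces has a nonzero vector outside [D]. *)
Lemma full_dichotomy (D : E -> Prop) X : H X ->
  exists Y, [/\ H Y, ae_sub Y X & all_of Y D \/ some_of Y (fun y => ~ D y)].
Proof.
move=> HX; pose D' v := nonzero v -> D v.
have [dD|ndD] := EM (dense_below H D' X).
  have [Z [HZ [ZX ZD]]] := fullH HX dD; exists Z; split=> //; first exact: ae_preceq.
  by left; exists 0%N => y yZ ny _; apply: ZD.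
have [Y [HY YX nZ]] : exists Y, [/\ H Y, preceq Y X & forall Z, is_block Z ->
    preceq Z Y -> ~ (forall v, span Z v -> D' v)].
  apply: contrapT => nY; apply: ndD => Y HY YX; apply: contrapT => nZ.
  by apply: nY; exists Y; split=> // Z bZ ZY ZD; apply: nZ; exists Z.
exists Y; split=> //; first exact: ae_preceq.
right=> Z bZ [n Hn]; apply: contrapT => nz.
apply: (nZ (tail Z n)); first exact: block_tail.
  move=> v vZ; apply: Hn; first exact: tail_preceq vZ.
  exact: above_tail vZ.
move=> v vZ nv; apply: contrapT => nD; apply: nz; exists v; split=> //.
exact: tail_preceq vZ.
Qed.

End Family.

(** * Projections of closed sets along the Cantor space *)


Section Compact.
Variables (F : countFieldType).
Local Notation seqs := (nat -> vec F).
Local Notation E := (vec F).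

Lemma not_Iwin (X : seqs) h (A : seqs -> Prop) : ~ Iwin X h A ->
  exists Y, [/\ is_block Y, mkseq Y (size h) = h & A Y].
Proof.
move=> nI; apply: contrapT => nY; apply: nI; exists (fun=> 0%N) => Y bY Yh _ AY.
by apply: nY; exists Y.
Qed.

Variable (H : seqs -> Prop).
Hypotheses (famH : is_family H) (pH : p_family H) (fullH : full H).

(** II guesses the parameter along the play, one bit per vector. At a rejected position some vector
    and some bit keep it rejected, for otherwise I could combine winning strategies for both bits;
    compactness enters in that only two bits compete. Each rejected position has a completion in
    [C], and these converge to the outcome paired with the guessed parameter. *)
Lemma compact_dichotomy (C : seqs -> (nat -> bool) -> Prop) X :
  (forall x t, (forall n, exists x' t', [/\ C x' t', agree n t t' &
     forall i, (i < n)%N -> x' i = x i]) -> C x t) -> H X ->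
  exists Y, [/\ H Y, ae_sub Y X & Iwin Y [::] (fun x => exists t, C x t) \/
    exists alpha, II_strategy_G Y alpha /\
      forall Ys, I_play_G Y Ys -> exists t, C (outcome_G alpha Ys) t].
Proof.
move=> Cclosed HX.
pose A (w : seq bool) Y := exists t, agree (size w) (nth false w) t /\ C Y t.
pose rej Y h w := forall Y', H Y' -> ae_sub Y' Y -> ~ Iwin Y' h (A w).
have [||X1 [HX1 X1X dec]] := @diagonalize F H famH pH (seq bool)
  (fun h w Y => Iwin Y h (A w) \/ rej Y h w) X HX.
- move=> h w Y Y' HY' Y'Y [acc|rj]; first by left; apply: Iwin_ae acc.
  by right=> Y'' HY'' Y''Y'; apply: rj => //; apply: ae_trans Y'Y.
- move=> h w Y fh HY YX; have [rj|nr] := EM (rej Y h w).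
    by exists Y; split=> //; [apply: ae_refl|right].
  have [Y' [HY' Y'Y acc]] : exists Y', [/\ H Y', ae_sub Y' Y & Iwin Y' h (A w)].
    apply: contrapT => nY; apply: nr => Y' HY' Y'Y acc; apply: nY.
    by exists Y'.
  by exists Y'; split=> //; left.
have [acc|rej0] := dec [::] [::] (@finsupps_nil F).
  exists X1; split=> //; left; apply: Iwin_sub acc => Y [t Ct].
  by exists t; split.
(* Rejection stays relative to the fixed [X1], so it is unaffected when [Y] shrinks. *)
have [||X2 [HX2 X2X1 next]] := @diagonalize F H famH pH (seq bool)
  (fun h w Y => size w = size h -> rej X1 h w ->
    some_of Y (fun y => exists b, rej X1 (rcons h y) (rcons w b))) X1 HX1.
- by move=> h w Y Y' _ Y'Y Hs sw rj; apply: some_of_ae Y'Y (Hs sw rj).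
- move=> h w Y fh HY YX1.
  have [Y' [HY' Y'Y [nrej|srej]]] := full_dichotomy fullH
    (fun y => ~ exists b, rej X1 (rcons h y) (rcons w b)) HY; last first.
    exists Y'; split=> // _ _; apply: some_of_sub srej => y _; exact: contrapT.
  exists Y'; split=> // sw rj; exfalso; apply: (rj _ HY').
    exact: ae_trans Y'Y YX1.
  have [n Hn] := nrej.
  have [L HL] := Iwin_choice Y' (fun r : seq E * nat => r.1)
    (fun r => A (rcons w (r.2 == 1%N))).
  (* Two strategies are taken up one move after [h]: index 0 for the bit [false], index 1 for
     [true]. *)
  have [s Hs] := follow_many (fun=> n)
    (fun h' => if size h' == (size h).+1 then 2%N else 0%N)
    (fun h' i => L (h', i)).
  exists s => Z bZ Zh HZ [t [tw Ct]].
  have Zh' : mkseq Z (size h).+1 = rcons h (Z (size h)) by rewrite mkseqS Zh.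
  have fZ : finsupp (Z (size h)) by case: (proj1 bZ (size h)).
  have [spZ aZ] := HZ _ (leqnn _).
  have [aZn _] := Hs _ _ _ aZ.
  pose b := t (size w).
  have acc : Iwin Y' (rcons h (Z (size h))) (A (rcons w b)).
    apply: (@Iwin_ae _ _ X1); first exact: ae_trans Y'Y YX1.
    have [//|rb] := dec _ (rcons w b) (finsupps_rcons fh fZ).
    case: (Hn _ spZ _ aZn); last by exists b.
    exact: (proj2 (proj1 bZ _)).
  have b1 : ((nat_of_bool b) == 1%N) = b by case: b {acc}.
  have := HL (rcons h (Z (size h)), nat_of_bool b) => /=; rewrite b1.
  move=> /(_ acc Z bZ); rewrite size_rcons => /(_ Zh'); apply.
    move=> k hk; have [spk ak] := HZ k (ltnW hk); split=> //.
    have [_ /(_ (size h).+1 (nat_of_bool b) hk)] := Hs _ _ _ ak.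
    rewrite size_mkseq eqxx Zh'; apply.
    by rewrite ltnS leq_b1.
  exists t; split=> // i; rewrite size_rcons ltnS leq_eqVlt nth_rcons.
  case/orP=> [/eqP ->|iw]; first by rewrite ltnn eqxx.
  by rewrite iw; apply: tw.
exists X2; split=> //; first exact: ae_trans X1X.
right.
have [||alpha [Ha1 Ha2]] := @II_strategy_of_step F (seq E * seq bool) X2
  (fun s => [/\ finsupps s.1, size s.2 = size s.1 & rej X1 s.1 s.2])
  (fun s y s' => s'.1 = rcons s.1 y /\ exists b, s'.2 = rcons s.2 b) ([::], [::]).
- by split=> //; apply: finsupps_nil.
- move=> [h w] [/= fh sw rj]; apply: some_of_sub (next h w fh sw rj) => y fy [b rb].
  exists (rcons h y, rcons w b); split=> /=; first by split=> //; exists b.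
  by split=> //; [apply: finsupps_rcons|rewrite !size_rcons sw].
exists alpha; split=> // Ys HYs; have [S [S0 HS]] := Ha2 Ys HYs.
set Y := outcome_G alpha Ys in HS *.
have SE k : (S k).1 = mkseq Y k.
  by elim: k => [|k IHk]; [rewrite S0|rewrite mkseqS -IHk; case: (HS k) => _ []].
have Sw k : size (S k).2 = k.
  by have [[_ -> _] _] := HS k; rewrite SE size_mkseq.
have pre k m i : (i < k)%N -> (k <= m)%N ->
    nth false (S m).2 i = nth false (S k).2 i.
  move=> ik; elim: m => [|m IHm]; first by rewrite leqn0 => /eqP <-.
  rewrite leq_eqVlt => /orP[/eqP <- //|km]; rewrite -IHm //.
  have [_ [_ [b ->]]] := HS m; rewrite nth_rcons Sw.
  by rewrite (leq_trans ik km).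
exists (fun i => nth false (S i.+1).2 i); apply: Cclosed => n.
have [[_ _ /(_ X1 HX1 (@ae_refl _ _)) nI] _] := HS n.
have [Z [bZ + [t [ta Ct]]]] := not_Iwin nI; rewrite SE size_mkseq => ZY.
exists Z, t; split=> // i ni.
  by rewrite -ta ?Sw // (pre i.+1 n).
by have := congr1 (fun l => nth (fun=> 0) l i) ZY; rewrite !nth_mkseq.
Qed.

End Compact.

(** * The parametrized pigeonhole principle *)


Section Pigeonhole.
Variables (F : countFieldType).
Local Notation seqs := (nat -> vec F).
Local Notation E := (vec F).
Implicit Types (t : nat -> bool) (p q : (nat -> bool) -> Prop).
Implicit Types (X Y Z : seqs) (a b y z : E) (h : seq E).

Lemma eq_span n Y Y' v : (forall i, (i < n)%N -> Y i = Y' i) ->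
  (exists c : nat -> F, forall k, v k = \sum_(i < n) c i * Y i k) -> span Y' v.
Proof.
move=> YY' [c vE]; exists n, c; split=> // k; rewrite vE; apply: eq_bigr => i _.
by rewrite YY'.
Qed.

Definition fspan h v := exists c : nat -> F,
  forall k, v k = \sum_(i < size h) c i * nth (fun=> 0) h i k.

Lemma fspan_nil v : fspan [::] v -> v = fun=> 0.
Proof. by move=> [c vE]; apply: funext => k; rewrite vE big_ord0. Qed.

Lemma fspan_rcons h y v : fspan (rcons h y) v ->
  exists a (l : F), fspan h a /\ v = fun k => a k + l * y k.
Proof.
move=> [c vE]; exists (fun k => \sum_(i < size h) c i * nth (fun=> 0) h i k), (c (size h)).
split; first by exists c.
apply: funext => k; rewrite vE size_rcons big_ord_recr /= nth_rcons ltnn eqxx.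
by congr (_ + _); apply: eq_bigr => i _; rewrite nth_rcons ltn_ord.
Qed.

Variable (H : seqs -> Prop).
Hypotheses (famH : is_family H) (stratH : strategic H).
Hypotheses (pH : p_family H) (fullH : full H).

Variables (D : (nat -> bool) -> E -> Prop).
Variables (p : (nat -> bool) -> Prop) (X : seqs).
Hypothesis openD : forall t y, p t -> finsupp y -> D t y ->
  exists k, forall t', p t' -> agree k t t' -> D t' y.

(** The set of pairs [(x, t)] such that the span of [x] misses [D t] is closed: a vector of the span
    uses finitely many terms, and [D t] is open in [t]. If II plays into it, strategicity puts an
    outcome in [H]; if I avoids it, each block sequence almost below [Y'] has an outcome inside its
    span, and that outcome meets every [D t]. *)
Lemma some_or_avoid q Y : perf q -> sub q p -> H Y ->
  exists Y', [/\ H Y', ae_sub Y' Y & (forall t, q t -> some_of Y' (D t)) \/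
    exists t, q t /\ forall y, span Y' y -> nonzero y -> ~ D t y].
Proof.
move=> [_ qC _] qp HY.
pose C (x : seqs) t := [/\ q t, is_block x &
  forall y, span x y -> nonzero y -> ~ D t y].
have [|Y1 [HY1 Y1Y [Iw|[alpha [Ha1 Ha2]]]]] :=
  compact_dichotomy famH pH fullH (C := C) _ HY; last first.
- have [Ys [HYs Hout]] := stratH HY1 Ha1.
  have [t [qt _ Ct]] := Ha2 Ys HYs; exists (outcome_G alpha Ys).
  split=> //; last by right; exists t.
  apply: ae_trans Y1Y; apply: ae_preceq; apply: preceq_of_terms => k.
  by have [_ sp] := Ha1 Ys HYs; apply: (proj2 (HYs k)); apply: sp.
- exists Y1; split=> //; left=> t qt Z bZ ZY1.
  have [Z' [bZ' Z'Z nC]] := Iwin_some_of Iw bZ ZY1.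
  apply: contrapT => nz; apply: nC; exists t; split=> // y yZ' ny Dy.
  by apply: nz; exists y; split=> //; apply: Z'Z.
move=> x t Hx.
have qt : q t.
  by apply: qC => n; have [x' [t' [[qt' _ _] a _]]] := Hx n; exists t'.
have bx : is_block x.
  split=> n.
    by have [x' [t' [[_ [b1 _] _] _ xx']]] := Hx n.+1; rewrite -xx'.
  move=> i j; have [x' [t' [[_ [_ b2] _] _ xx']]] := Hx n.+2.
  rewrite -!xx' //; exact: b2.
split=> // y /[dup] /(finsupp_span bx) fy [N [c [_ yE]]] ny Dy.
have [k Hk] := openD (qp _ qt) fy Dy.
have [x' [t' [[qt' _ av] a xx']]] := Hx (maxn N k).
apply: (av y); last 1 first.
- by apply: Hk; [apply: qp|apply: agreeW a; apply: leq_maxr].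
- apply: (@eq_span N x); last by exists c.
  by move=> i iN; rewrite xx' // leq_max iN.
- by [].
Qed.

(** That is, the subspace spanned by [h] and [Y] together misses [D t] away from zero. *)
Definition avoid t h Y := forall a b, fspan h a -> span Y b ->
  nonzero (fun k => a k + b k) -> ~ D t (fun k => a k + b k).

Lemma avoid_preceq t h Y Y' : preceq Y' Y -> avoid t h Y -> avoid t h Y'.
Proof. by move=> Y'Y av a b fa /Y'Y; apply: av. Qed.

Lemma avoid_rcons t h y Y : span Y y -> avoid t h Y -> avoid t (rcons h y) Y.
Proof.
move=> yY av _ b /fspan_rcons[a [l [fa ->]]] bY.
have -> : (fun k => a k + l * y k + b k) = (fun k => a k + (l * y k + b k)).
  by apply: funext => k; rewrite addrA.
by apply: av => //; apply: span_lin.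
Qed.

Definition kill h q Y := forall t Y', q t -> H Y' -> ae_sub Y' Y ->
  ~ avoid t h Y'.

Definition unkillable h q Y := forall q' Y', perf q' -> sub q' q -> H Y' ->
  ae_sub Y' Y -> ~ kill h q' Y'.

Lemma unkillable_sub h q q' Y Y' : sub q' q -> ae_sub Y' Y ->
  unkillable h q Y -> unkillable h q' Y'.
Proof.
move=> q'q Y'Y nk q'' Y'' pq'' q''q' HY'' Y''Y'; apply: nk => //.
  exact: sub_trans q'q.
exact: ae_trans Y'Y.
Qed.

Lemma unkillable_avoid h q Y : perf q -> H Y -> unkillable h q Y ->
  exists t Y', [/\ q t, H Y', preceq Y' Y & avoid t h Y'].
Proof.
move=> pq HY nk.
have /existsNP[t /existsNP[Y']] : ~ kill h q Y.
  by apply: nk => //; apply: ae_refl.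
move=> /not_implyP[qt /not_implyP[HY' /not_implyP[Y'Y /contrapT av]]].
have [Y2 [HY2 Y2Y Y2Y']] := H_refine famH HY' Y'Y.
by exists t, Y2; split=> //; apply: avoid_preceq av.
Qed.

(** The pieces are served one after another. The sequences decrease under [preceq], not just
    [ae_sub], because [avoid] is inherited by genuine subspaces. *)
Lemma avoid_list (I : eqType) (l : seq I) (tau : I -> nat -> bool) h m p1 Y :
  perf p1 -> H Y ->
  (forall i, i \in l -> p1 (tau i) /\ unkillable h (piece p1 m (tau i)) Y) ->
  exists (tau' : I -> nat -> bool) Y', [/\ H Y', preceq Y' Y & forall i, i \in l ->
    piece p1 m (tau i) (tau' i) /\ avoid (tau' i) h Y'].
Proof.
move=> pp1 HY; elim: l => [|i l IHl] Hl; first by exists tau, Y; split.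
have [j jl|tau' [Y1 [HY1 Y1Y Hav]]] := IHl.
  by apply: Hl; rewrite inE jl orbT.
have [p1i nki] := Hl i (mem_head _ _).
have [||t [Y2 [pt HY2 Y2Y1 av]]] :=
  @unkillable_avoid h (piece p1 m (tau i)) Y1 _ HY1.
- exact: perf_piece_mem.
- by apply: unkillable_sub nki => //; apply: ae_preceq.
exists (fun j => if j == i then t else tau' j), Y2; split=> //.
  by move=> v /Y2Y1 /Y1Y.
move=> j; rewrite inE; case: eqP => [-> _|_ /= jl]; first by split.
by have [? ?] := Hav j jl; split=> //; apply: avoid_preceq Y2Y1 _.
Qed.

(* In a state (h, (k, S)), h is the outcome so far and the strings in S, all of
   length k, name the pieces of p1 that survive in the perfect set being built. *)
Definition good p1 X1 (s : seq E * (nat * seq (seq bool))) :=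
  [/\ finsupps s.1, s.2.2 != [::] & forall c, c \in s.2.2 ->
     [/\ size c = s.2.1, exists t, piece p1 s.2.1 (nth false c) t &
         unkillable s.1 (piece p1 s.2.1 (nth false c)) X1]].

Definition step (s : seq E * (nat * seq (seq bool))) y
    (s' : seq E * (nat * seq (seq bool))) :=
  [/\ s'.1 = rcons s.1 y, (s.2.1 < s'.2.1)%N,
   forall c, c \in s'.2.2 -> take s.2.1 c \in s.2.2 &
   forall c, c \in s.2.2 -> exists c1 c2, [/\ c1 \in s'.2.2, c2 \in s'.2.2,
      take s.2.1 c1 = c, take s.2.1 c2 = c & c1 <> c2]].

(** Each surviving piece is split in two, and in each half a point [tau] is found so that one common
    [Y1] avoids together with [h] at all these points. A vector [y] of [Y1] leaves this intact by
    [avoid_rcons], so the piece around [tau] is not killed at [rcons h y]; being decided, it is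
    unkillable. *)
Lemma good_step p1 X1 s Y : perf p1 -> H X1 ->
  (forall h, finsupps h -> exists k, forall t, p1 t ->
     kill h (piece p1 k t) X1 \/ unkillable h (piece p1 k t) X1) ->
  H Y -> ae_sub Y X1 -> good p1 X1 s -> exists Y', [/\ H Y', ae_sub Y' Y &
    all_of Y' (fun y => exists s', step s y s' /\ good p1 X1 s')].
Proof.
case: s => [h [k S]] pp1 HX1 dec HY YX1 [/= fh Sne HS].
have [r Hr] : {r : seq bool -> (bool -> nat -> bool) * nat & forall c, c \in S ->
  (forall e, piece p1 k (nth false c) ((r c).1 e)) /\
  (r c).1 true (r c).2 <> (r c).1 false (r c).2}.
  apply: (@choice _ _ (fun c (r : (bool -> nat -> bool) * nat) => c \in S ->
    (forall e, piece p1 k (nth false c) (r.1 e)) /\ r.1 true r.2 <> r.1 false r.2)).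
  move=> c; case cS: (c \in S); last by exists (fun _ _ => true, 0%N).
  have [_ [t pt] _] := HS c cS.
  have [_ _ /(_ t 0%N pt)[t' [pt' _ /neq_index[i Hi]]]] := perf_piece pp1 (ex_intro _ t pt).
  by exists (fun e => if e then t' else t, i) => _; split=> // -[].
(* Beyond an index at which the two points chosen in each piece differ, so that pieces of length [m]
   keep the halves apart. *)
pose m := (maxn k (\max_(c <- S) (r c).2)).+1.
pose l := [seq (e, c) | e <- [:: true; false], c <- S].
have meml e c : ((e, c) \in l) = (c \in S).
  apply/allpairsP/idP => [[[e' c'] [/= _ + [_ ->]]] //|cS].
  by exists (e, c); split=> //; case: e.
have km : (k < m)%N by rewrite ltnS leq_maxl.
have rm c : c \in S -> ((r c).2 < m)%N.
  move=> cS; rewrite ltnS leq_max; apply/orP; right.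
  exact: (@leq_bigmax_seq _ S xpredT (fun c => (r c).2)).
have [|tau [Y1 [HY1 Y1Y Htau]]] := @avoid_list _ l (fun i => (r i.2).1 i.1)
    h m p1 Y pp1 HY.
  move=> [e c]; rewrite meml => cS /=.
  have [/(_ e)[p1r a] _] := Hr c cS; split=> //.
  have [_ _ nk] := HS c cS; apply: unkillable_sub nk => //.
  exact: piece_le (ltnW km) a.
exists Y1; split=> //; first exact: ae_preceq.
exists 0%N => y yY1 ny _.
have fy := finsupp_span (H_block famH HY1) yY1.
have fhy := finsupps_rcons fh fy.
have [j Hj] := dec _ fhy.
pose k' := maxn m j.
have Htau' e c : c \in S -> [/\ p1 (tau (e, c)),
    agree m ((r c).1 e) (tau (e, c)), take k (mkseq (tau (e, c)) k') = c &
    unkillable (rcons h y) (piece p1 k' (tau (e, c))) X1].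
  move=> cS; have [|[p1t a] av] := Htau (e, c); first by rewrite meml.
  have kk' : (k <= k')%N by rewrite leq_max (ltnW km).
  split=> //.
    rewrite take_mkseq // -(eq_mkseq_agree (agreeW (ltnW km) a)) /=.
    have [/(_ e)[_ a'] _] := Hr c cS; rewrite -(eq_mkseq_agree a').
    have [<- _ _] := HS c cS; exact: mkseq_nth.
  have [kl|nk] := Hj _ p1t.
    exfalso; apply: (kl (tau (e, c)) Y1) => //.
      by apply: ae_trans YX1; apply: ae_preceq.
    exact: avoid_rcons.
  apply: unkillable_sub nk; last exact: ae_refl.
  by apply: piece_le (leq_maxr _ _) _.
exists (rcons h y, (k', [seq mkseq (tau i) k' | i <- l])); split.
  split=> //=; first by rewrite leq_max km.
    move=> _ /mapP[[e c] + ->]; rewrite meml => cS.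
    by have [_ _ ->] := Htau' e c cS.
  move=> c cS; exists (mkseq (tau (true, c)) k'), (mkseq (tau (false, c)) k').
  have [_ a1 t1 _] := Htau' true c cS; have [_ a2 t2 _] := Htau' false c cS.
  split=> //; try by apply/mapP; eexists; last reflexivity; rewrite meml.
  move=> /(congr1 (fun u => nth false u (r c).2)).
  have rk' : ((r c).2 < k')%N by rewrite leq_max rm.
  rewrite !nth_mkseq // -a1 ?rm // -a2 ?rm //.
  by have [] := Hr c cS.
split=> //=.
  have [c cS] : exists c, c \in S.
    by move: Sne; case: (S) => // c s _; exists c; rewrite mem_head.
  apply/eqP => l0; have : mkseq (tau (true, c)) k' \in [seq mkseq (tau i) k' | i <- l].
    by apply/mapP; exists (true, c); rewrite ?meml.
  by rewrite l0.
move=> _ /mapP[[e c] + ->]; rewrite meml => cS.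
have [p1t _ _ nk] := Htau' e c cS; split; first by rewrite size_mkseq.
  by exists (tau (e, c)); split=> //; apply: agree_mkseq.
apply: unkillable_sub nk; last exact: ae_refl.
by apply: piece_le => //; apply: agree_sym; apply: agree_mkseq.
Qed.

(** If no condition realizes the second alternative, [some_or_avoid] makes the empty position
    unkillable. II then plays in $G[X_2]$ while growing a tree of surviving strings; strategicity
    provides an outcome [Y] in [H], and the branches of the tree form the perfect set. *)
Lemma param_pigeonhole : perf p -> H X ->
  exists q Y, [/\ perf q, sub q p, H Y, ae_sub Y X &
    (forall t y, q t -> span Y y -> nonzero y -> ~ D t y) \/
    forall t, q t -> some_of Y (D t)].
Proof.
move=> pp HX.
have [[q [Y [pq qp HY YX sD]]]|nb] := EM (exists q Y, [/\ perf q, sub q p, H Y,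
    ae_sub Y X & forall t, q t -> some_of Y (D t)]).
  by exists q, Y; split=> //; right.
have [||p1 [X1 [pp1 p1p HX1 X1X dec]]] := @fusion F H famH pH unit
  (fun h _ q Y => kill h q Y \/ unkillable h q Y) p X pp HX.
- move=> h _ q q' Y Y' q'q _ HY' Y'Y [kl|nk]; [left|right].
    by move=> t Y'' /q'q qt HY'' Y''Y'; apply: kl => //; apply: ae_trans Y'Y.
  exact: unkillable_sub nk.
- move=> h _ q Y fh pq qp HY YX.
  have [nk|/existsNP[q' /existsNP[Y']]] := EM (unkillable h q Y).
    by exists q, Y; split=> //; [apply: ae_refl|right].
  move=> /not_implyP[pq' /not_implyP[q'q /not_implyP[HY' /not_implyP[Y'Y]]]].
  by move=> /contrapT kl; exists q', Y'; split=> //; left.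
have good0 : good p1 X1 ([::], (0%N, [:: [::]])).
  split=> //=; first exact: finsupps_nil.
  move=> c; rewrite inE => /eqP ->; split=> //.
    by have [[t p1t] _ _] := pp1; exists t.
  move=> q Y pq qp1 HY YX1 kl.
  have qp : sub q p by move=> t /qp1[/p1p].
  have [Y' [HY' Y'Y [sD|[t [qt av]]]]] := some_or_avoid pq qp HY.
    apply: nb; exists q, Y'; split=> //.
    by apply: ae_trans Y'Y _; apply: ae_trans YX1 _.
  apply: (kl t Y') => // a b /fspan_nil -> bY.
  have -> : (fun k => 0 + b k) = b by apply: funext => k; rewrite add0r.
  by move=> nzb; apply: av.
have [||X2 [HX2 X2X1 next]] := @diagonalize F H famH pH (nat * seq (seq bool))%type
  (fun h r Y => good p1 X1 (h, r) ->
     all_of Y (fun y => exists s', step (h, r) y s' /\ good p1 X1 s')) X1 HX1.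
- by move=> h r Y Y' _ Y'Y Hs gs; apply: all_of_ae Y'Y (Hs gs).
- move=> h r Y fh HY YX1; have [gs|ngs] := EM (good p1 X1 (h, r)); last first.
    by exists Y; split=> //; apply: ae_refl.
  have [|Y' [HY' Y'Y HD]] := good_step pp1 HX1 _ HY YX1 gs; last by exists Y'.
  by move=> h' fh'; have [k Hk] := dec h' tt fh'; exists k.
have [|alpha [Ha1 Ha2]] := @II_strategy_of_step F _ X2 (good p1 X1) step _ good0.
  move=> [h r] gs; apply: all_some; first exact: H_block HX2.
  by apply: next => //; case: gs.
have [Ys [HYs HY]] := stratH HX2 Ha1; have [S [S0 HS]] := Ha2 Ys HYs.
set Y := outcome_G alpha Ys in HS HY *.
have YX2 : preceq Y X2.
  apply: preceq_of_terms => k; have [_ sp] := Ha1 Ys HYs.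
  by apply: (proj2 (HYs k)); apply: sp.
have SE k : (S k).1 = mkseq Y k.
  elim: k => [|k IHk]; first by rewrite S0.
  by rewrite mkseqS -IHk; case: (HS k) => _ [].
pose l n := (S n).2.1; pose C n := (S n).2.2.
(* Stage [n] of the perfect set: the points through the strings that survive after [n] vectors. *)
pose q n t := mkseq t (l n) \in C n.
have Csz n c : c \in C n -> size c = l n.
  by have [[_ _ Hc] _] := HS n => /Hc[].
have lS n : (l n < l n.+1)%N by have [_ []] := HS n.
have nthC n c : c \in C n -> mkseq (nth false c) (l n) = c.
  by move=> /Csz <-; apply: mkseq_nth.
have takeA n c c' : take (l n) c' = c -> agree (l n) (nth false c) (nth false c').
  by move=> <- i il; rewrite nth_take.
have takeC n t : take (l n) (mkseq t (l n.+1)) = mkseq t (l n).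
  by rewrite take_mkseq // ltnW.
have branch n c : c \in C n -> exists c1 c2, [/\ c1 \in C n.+1, c2 \in C n.+1,
      take (l n) c1 = c, take (l n) c2 = c & c1 <> c2].
  by have [_ [_ _ _ Hb]] := HS n; apply: Hb.
have qS n : sub (q n.+1) (q n).
  move=> t; rewrite /q; have [_ [_ _ Ht _]] := HS n => /Ht.
  by rewrite -/(l n) takeC.
have pq : perf (fun t => forall n, q n t).
  apply: (perf_scheme (l := l)) => //.
  - by exists (fun=> true); rewrite /q /C /l S0.
  - move=> n t Ht; have [t' [qt' a]] := Ht (l n).
    by rewrite /q (eq_mkseq_agree a).
  - move=> n t qt; have [c1 [_ [c1C _ tc1 _ _]]] := branch n _ qt.
    exists (nth false c1); split; first by rewrite /q nthC.
    apply: agree_trans (takeA _ _ _ tc1).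
    by apply: agree_sym; apply: agree_mkseq.
  move=> n t qt; have [c1 [c2 [c1C c2C tc1 tc2 ne]]] := branch n _ (qS _ _ qt).
  have main c : c \in C n.+1 -> take (l n) c = mkseq t (l n) ->
    c <> mkseq t (l n.+1) -> exists t', [/\ q n.+1 t', agree (l n) t t'
      & ~ agree (l n.+1) t t'].
    move=> cC tc nc; exists (nth false c); split; first by rewrite /q nthC.
      apply: agree_trans (takeA _ _ _ tc).
      by apply: agree_sym; apply: agree_mkseq.
    by move=> a; apply: nc; rewrite (eq_mkseq_agree a) nthC.
  have [e1|n1] := EM (c1 = mkseq t (l n.+1)); last exact: main n1.
  by apply: (main c2) => //; rewrite -e1 => e2; apply: ne.
have ln n : (n <= l n)%N by elim: n => // n IHn; apply: leq_ltn_trans IHn (lS n).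
exists (fun t => forall n, q n t), Y.
have qp1 : sub (fun t => forall n, q n t) p1.
  move=> t qt; have [_ p1C _] := pp1; apply: p1C => k.
  have [[_ _ Hc] _] := HS k; have [_ [t' [p1t' a]] _] := Hc _ (qt k).
  exists t'; split=> //; apply: agreeW (ln k) _; apply: agree_trans a.
  exact: agree_sym (@agree_mkseq _ _).
split=> //.
- exact: sub_trans p1p.
- by apply: ae_trans X1X; apply: ae_trans X2X1; apply: ae_preceq.
left=> t y qt yY ny Dty.
have fy := finsupp_span (H_block famH HY) yY.
have [k Hk] := openD (p1p _ (qp1 _ qt)) fy Dty.
have [N [c [cN yE]]] := proj1 (spanE _ _) yY.
(* At stage [n] the vector [y] is a combination of moves already made, and [D t y] persists
   throughout the piece of [t]. Unkillability finds in that piece a [t'] that avoids, which is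
   refuted by writing [y] as [y + 0]. *)
pose n := maxn N k.
have [[_ _ Hc] _] := HS n; have [_ ne nk] := Hc _ (qt n).
have [|t' [Y' [[p1t' a] _ _ av]]] := unkillable_avoid _ HX1 nk.
  exact: perf_piece.
have y0 : (fun k => y k + 0) = y by apply: funext => i; rewrite addr0.
have := av y (fun=> 0); rewrite y0; apply => //; last first.
- apply: Hk; first exact: p1p.
  apply: agreeW (leq_trans (leq_maxr N k) (ln n)) _; apply: agree_trans a.
  exact: agree_sym (@agree_mkseq _ _).
- exact: span0.
exists c => i; rewrite SE size_mkseq (yE n) ?leq_maxl //.
by apply: eq_bigr => j _; rewrite nth_mkseq.
Qed.

End Pigeonhole.

(** * The dichotomy over the Cantor space *)


Section Reach.
Variables (F : countFieldType).
Local Notation seqs := (nat -> vec F).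
Local Notation E := (vec F).
Implicit Types (X Y Z : seqs) (y z : E) (h : seq E).

(* A well-founded strategy of II in an open game, kept as a tree so that II can
   carry the remaining subtree along and no play follows it forever. *)
Inductive plan := Stop | Move of (seqs -> E) & (seqs -> plan).

Fixpoint reaches X (O : seq E -> Prop) h (a : plan) : Prop :=
  match a with
  | Stop => O h
  | Move f g => forall Z, is_block Z -> ae_sub Z X ->
      [/\ span Z (f Z), nonzero (f Z) & reaches X O (rcons h (f Z)) (g Z)]
  end.

Definition Reach X O h := exists a, reaches X O h a.

Lemma Reach_stop X (O : seq E -> Prop) h : O h -> Reach X O h.
Proof. by move=> Oh; exists Stop. Qed.

Lemma Reach_move X O h :
  some_of X (fun y => Reach X O (rcons h y)) -> Reach X O h.
Proof.
move=> sR.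
have [r Hr] : {r : seqs -> E * plan & forall Z, is_block Z -> ae_sub Z X ->
    [/\ span Z (r Z).1, nonzero (r Z).1 & reaches X O (rcons h (r Z).1) (r Z).2]}.
  apply: (@choice _ _ (fun Z (r : E * plan) => is_block Z -> ae_sub Z X ->
    [/\ span Z r.1, nonzero r.1 & reaches X O (rcons h r.1) r.2])) => Z.
  have [[bZ ZX]|nZ] := EM (is_block Z /\ ae_sub Z X); last first.
    by exists (fun=> 0, Stop) => bZ ZX; case: nZ.
  by have [z [zZ nz [a Ha]]] := sR Z bZ ZX; exists (z, a).
by exists (Move (fun Z => (r Z).1) (fun Z => (r Z).2)).
Qed.

Lemma Reach_ae X Y O h : ae_sub Y X -> Reach X O h -> Reach Y O h.
Proof.
move=> YX [a Ha]; exists a; elim: a h Ha => // f g IHg h Ha Z bZ ZY.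
by have [? ? ?] := Ha Z bZ (ae_trans ZY YX); split=> //; apply: IHg.
Qed.

Definition subplan (a' a : plan) := exists f g Z, a = Move f g /\ a' = g Z.

Lemma no_infinite_subplan (f : nat -> plan) :
  ~ (forall n, subplan (f n.+1) (f n)).
Proof.
move: {2}(f 0%N) (erefl (f 0%N)) => a; elim: a f => [|u g IHg] f f0 Hf.
  by have [? [? [? [e _]]]] := Hf 0%N; rewrite e in f0.
have [u' [g' [Z [e1 e2]]]] := Hf 0%N.
move: e1; rewrite f0 => -[_ eg].
by apply: (IHg Z (fun n => f n.+1)) => [|n]; rewrite ?eg.
Qed.

End Reach.

Section Dichotomy.
Variables (F : countFieldType).
Local Notation seqs := (nat -> vec F).
Local Notation E := (vec F).
Implicit Types (t : nat -> bool) (p q : (nat -> bool) -> Prop).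
Implicit Types (X Y Z : seqs) (y : E) (h : seq E) (w : seq nat).
Variable (H : seqs -> Prop).
Hypotheses (famH : is_family H) (stratH : strategic H).
Hypotheses (pH : p_family H) (fullH : full H).
Variable C : (nat -> bool) -> seqs -> (nat -> nat) -> Prop.
Hypothesis closedC : forall t x z, (forall n, exists t' x' z',
  [/\ C t' x' z', agree n t t' & forall i, (i < n)%N -> x' i = x i /\ z' i = z i]) ->
  C t x z.

Definition proj w t Y :=
  exists z : nat -> nat, (forall i, (i < size w)%N -> z i = nth 0%N w i) /\ C t Y z.

(** The quantifier over [t] is inside the avoided set: one strategy of I serves all of [q]. *)
Definition acc q Y h w := Iwin Y h (fun Z => exists t, q t /\ proj w t Z).

Definition rej q Y h w := forall q' Y', perf q' -> sub q' q -> H Y' ->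
  ae_sub Y' Y -> ~ acc q' Y' h w.

Lemma acc_sub q q' Y Y' h w : sub q' q -> ae_sub Y' Y ->
  acc q Y h w -> acc q' Y' h w.
Proof.
move=> q'q Y'Y aq; apply: Iwin_ae Y'Y _; apply: Iwin_sub aq => Z [t [/q'q qt pt]].
by exists t.
Qed.

Lemma rej_sub q q' Y Y' h w : sub q' q -> ae_sub Y' Y ->
  rej q Y h w -> rej q' Y' h w.
Proof.
move=> q'q Y'Y rq q'' Y'' pq'' q''q' HY'' Y''Y'; apply: rq => //.
  exact: sub_trans q'q.
exact: ae_trans Y'Y.
Qed.

(** I plays the maximum of finitely many strategies, one for each string of length [k]. *)
Lemma acc_pieces q p k Y h w : sub q p ->
  (forall t, q t -> acc (piece p k t) Y h w) -> acc q Y h w.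
Proof.
move=> qp aq.
have [L HL] := Iwin_choice Y (fun _ : seq bool => h)
  (fun c Z => exists t, piece p k (nth false c) t /\ proj w t Z).
exists (fun h' => \max_(c <- strings k) L c h') => Z bZ Zh HZ [t [qt pt]].
apply: (HL (mkseq t k) _ Z bZ Zh) => [|j hj|].
- apply: acc_sub (aq t qt); last exact: ae_refl.
  by apply: piece_le => //; apply: agree_sym; apply: agree_mkseq.
- have [sp ab] := HZ j hj; split=> //; apply: aboveW ab.
  exact: (@leq_bigmax_seq _ _ xpredT (fun c => L c _) _ (mem_strings k t)).
exists t; split=> //; split; first exact: qp.
exact: agree_mkseq.
Qed.

Section Decided.
Variables (p1 : (nat -> bool) -> Prop) (X1 : seqs).
Hypothesis dec1 : forall h w, finsupps h -> exists k, forall t, p1 t ->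
  acc (piece p1 k t) X1 h w \/ rej (piece p1 k t) X1 h w.

Definition bad t h w := exists k, rej (piece p1 k t) X1 h w.

Lemma bad_open k t t' h w : agree k t t' -> rej (piece p1 k t) X1 h w -> bad t' h w.
Proof.
move=> a rk; exists k; apply: rej_sub rk; last exact: ae_refl.
exact: piece_le (leqnn k) a.
Qed.

(** II's goal from a bad position of length [r.1] with witness segment [r.2]. The bound on [m]
    leaves I finitely many next values to handle at each position, yet every [m] qualifies once the
    position is long enough. *)
Definition target (r : nat * seq nat) t h :=
  (r.1 < size h)%N /\ exists m, (m <= size h)%N /\ bad t h (rcons r.2 m).

Definition acc2 r q Y h := forall t, q t -> Reach Y (target r t) h.

Definition rej2 r q Y h := forall q' Y', perf q' -> sub q' q -> H Y' ->
  ae_sub Y' Y -> ~ acc2 r q' Y' h.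

Lemma acc2_sub r q q' Y Y' h : sub q' q -> ae_sub Y' Y ->
  acc2 r q Y h -> acc2 r q' Y' h.
Proof. by move=> q'q Y'Y aq t /q'q /aq; apply: Reach_ae. Qed.

Lemma rej2_sub r q q' Y Y' h : sub q' q -> ae_sub Y' Y ->
  rej2 r q Y h -> rej2 r q' Y' h.
Proof.
move=> q'q Y'Y rq q'' Y'' pq'' q''q' HY'' Y''Y'; apply: rq => //.
  exact: sub_trans q'q.
exact: ae_trans Y'Y.
Qed.

Lemma rej2_pieces r q p k Y h : sub q p ->
  (forall t, q t -> rej2 r (piece p k t) Y h) -> rej2 r q Y h.
Proof.
move=> qp rq q' Y' pq' q'q HY' Y'Y aq'; have [[t q't] _ _] := pq'.
apply: (rq t (q'q t q't) (piece q' k t) Y') => //.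
- exact: perf_piece_mem.
- by move=> u [/q'q /qp].
by apply: acc2_sub aq'; [apply: piece_sub|apply: ae_refl].
Qed.

Lemma rej2_not_target r q Y h t : perf q -> sub q p1 -> H Y ->
  rej2 r q Y h -> q t -> ~ target r t h.
Proof.
move=> pq qp1 HY rq qt [rh [m [mh [k rk]]]].
apply: (rq (piece q k t) Y) => //.
- exact: perf_piece_mem.
- exact: piece_sub.
- exact: ae_refl.
move=> u [qu a]; apply: Reach_stop; split=> //; exists m; split=> //.
exact: bad_open rk.
Qed.

Section Decided2.
Variables (p2 : (nat -> bool) -> Prop) (X2 : seqs).
Hypotheses (p2p1 : sub p2 p1) (X2X1 : ae_sub X2 X1).
Hypothesis dec2 : forall h r, finsupps h -> exists k, forall t, p2 t ->
  acc2 r (piece p2 k t) X2 h \/ rej2 r (piece p2 k t) X2 h.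

Definition next_decided r h q Y :=
  acc2 r q Y h \/ all_of Y (fun y => rej2 r q X2 (rcons h y)).

(** The parametrized pigeonhole is applied to the vectors after which II can reach the target. [D]
    asks for this on a whole piece around [t], which makes it open in [t]. *)
Lemma next_decided_dense r h q Y : finsupps h -> perf q -> sub q p2 -> H Y ->
  ae_sub Y X2 -> exists q' Y', [/\ perf q', sub q' q, H Y', ae_sub Y' Y &
    next_decided r h q' Y'].
Proof.
move=> fh pq qp2 HY YX2.
have [kk Hkk] : {kk : E -> nat & forall y, finsupp y -> forall t, p2 t ->
    acc2 r (piece p2 (kk y) t) X2 (rcons h y) \/
    rej2 r (piece p2 (kk y) t) X2 (rcons h y)}.
  apply: (@choice _ _ (fun y k => finsupp y -> forall t, p2 t ->
    acc2 r (piece p2 k t) X2 (rcons h y) \/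
    rej2 r (piece p2 k t) X2 (rcons h y))) => y.
  have [fy|nf] := EM (finsupp y); last by exists 0%N.
  by have [k Hk] := dec2 r (finsupps_rcons fh fy); exists k.
pose D t y := acc2 r (piece p2 (kk y) t) X2 (rcons h y).
have [|q' [Y' [pq' q'q HY' Y'Y [nD|sD]]]] :=
  param_pigeonhole famH stratH pH fullH (D := D) _ pq HY.
- move=> t y _ fy Dt; exists (kk y) => t' _ a.
  by apply: acc2_sub Dt; [apply: piece_le|apply: ae_refl].
- exists q', Y'; split=> //; right; exists 0%N => y yY' ny _.
  apply: (@rej2_pieces _ _ p2 (kk y)) => [|t q't]; first exact: sub_trans q'q qp2.
  have fy := finsupp_span (H_block famH HY') yY'.
  have [a|//] := Hkk y fy t (qp2 _ (q'q _ q't)).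
  by case: (nD t y q't yY' ny).
exists q', Y'; split=> //; left=> t q't; apply: Reach_move.
apply: some_of_sub (sD t q't) => y _ Dy; apply: (@Reach_ae _ X2).
  exact: ae_trans Y'Y YX2.
by apply: Dy; split=> //; apply/qp2/q'q.
Qed.

Section Decided3.
Variables (p3 : (nat -> bool) -> Prop) (X3 : seqs).
Hypotheses (pp3 : perf p3) (HX3 : H X3) (HX2 : H X2).
Hypotheses (p3p2 : sub p3 p2) (X3X2 : ae_sub X3 X2).
Hypothesis dec3 : forall h r, finsupps h -> exists k, forall t, p3 t ->
  next_decided r h (piece p3 k t) X3.

(** Acceptance on a piece would contradict the rejection of [h], so each piece gives the second
    alternative of [next_decided]. Its threshold depends on [k] bits only and can be made
    uniform. *)
Lemma rej2_next r q h : finsupps h -> perf q -> sub q p3 -> rej2 r q X2 h ->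
  all_of X3 (fun y => rej2 r q X2 (rcons h y)).
Proof.
move=> fh pq qp3 rq; have [k Hk] := dec3 r fh.
have [|||n Hn] := @uniform_bound k q (fun t n => forall y, span X3 y ->
  nonzero y -> above n y -> rej2 r (piece p3 k t) X2 (rcons h y)).
- move=> t t' n a Ht y yX ny ay; apply: rej2_sub (Ht y yX ny ay).
    exact: piece_le a.
  exact: ae_refl.
- by move=> t m n mn Ht y yX ny ay; apply: Ht => //; apply: aboveW ay.
- move=> t qt; have [a|[n Hn]] := Hk t (qp3 _ qt); last by exists n.
  exfalso; apply: (rq (piece q k t) X3) => //.
  + exact: perf_piece_mem.
  + exact: piece_sub.
  by apply: acc2_sub a; [apply: piece_mono|apply: ae_refl].
exists n => y yX ny ay; apply: (@rej2_pieces _ _ p3 k) => // t qt.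
exact: Hn.
Qed.

(** Otherwise reaching the target is rejected on a piece [q], and by [rej2_next] I can keep it
    rejected forever. No later position is then a target, so at a position of length [j] the
    extension of [w] by any [m <= j] is accepted. I joins these strategies as they become available
    and thereby accepts [h] with [w] on [q], against badness. *)
Lemma bad_Reach t h w : p3 t -> finsupps h -> bad t h w ->
  Reach X3 (target (size h, w) t) h.
Proof.
move=> p3t fh [k rk]; pose r := (size h, w).
have [k2 /(_ t (p3p2 p3t)) [a2|r2]] := dec2 r fh.
  by apply: Reach_ae X3X2 _; apply: a2; apply: piece_mem; apply: p3p2.
pose q := piece p3 (maxn k k2) t.
have pq : perf q by apply: perf_piece_mem.
have qp3 : sub q p3 by apply: piece_sub.
have qp1 : sub q p1 by move=> u /qp3 /p3p2 /p2p1.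
have rq : rej2 r q X2 h.
  apply: rej2_sub r2; last exact: ae_refl.
  move=> u [/p3p2 p2u a]; split=> //; apply: agreeW a; exact: leq_maxr.
exfalso; apply: (rk q X3) => //.
- move=> u [/p3p2 /p2p1 p1u a]; split=> //; apply: agreeW a; exact: leq_maxl.
- exact: ae_trans X3X2 X2X1.
have [n Hn] : {n : seq E -> nat & forall h', finsupps h' -> rej2 r q X2 h' ->
    forall y, span X3 y -> nonzero y -> above (n h') y ->
    rej2 r q X2 (rcons h' y)}.
  apply: (@choice _ _ (fun h' n => finsupps h' -> rej2 r q X2 h' ->
    forall y, span X3 y -> nonzero y -> above n y ->
    rej2 r q X2 (rcons h' y))) => h'.
  have [[fh' rh']|nr] := EM (finsupps h' /\ rej2 r q X2 h'); last first.
    by exists 0%N => fh' rh'; case: nr.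
  by have [n Hn] := rej2_next fh' pq qp3 rh'; exists n.
have [L HL] := Iwin_choice X3 (fun i : seq E * nat => i.1)
  (fun i Z => exists t', q t' /\ proj (rcons w i.2) t' Z).
have [s Hs] := follow_many n
  (fun h' => if (size h < size h')%N then (size h').+1 else 0%N)
  (fun h' i => L (h', i)).
exists s => Z bZ Zh HZ [t' [qt' [z [zw Cz]]]].
have fZ j : finsupps (mkseq Z j) by apply: finsupps_mkseq.
have rejZ j : (size h <= j)%N -> rej2 r q X2 (mkseq Z j).
  elim: j => [|j IHj]; first by rewrite leqn0 => /eqP s0; rewrite -s0 Zh.
  rewrite leq_eqVlt => /orP[/eqP <-|]; first by rewrite Zh.
  rewrite ltnS => hj; have [sp ab] := HZ j hj.
  have [ab0 _] := Hs _ _ _ ab; rewrite mkseqS; apply: Hn => //.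
    exact: IHj.
  exact: (proj2 (proj1 bZ j)).
(* [j] is the first length beyond that of [h] at which I takes up the strategy for the value [m]. *)
pose m := z (size w); pose j := maxn m (size h).+1.
have hj : (size h < j)%N by rewrite leq_max leqnn orbT.
have mj : (m <= j)%N by rewrite leq_maxl.
have accj : acc q X3 (mkseq Z j) (rcons w m).
  apply: (@acc_sub q q X1); [by []|exact: ae_trans X3X2 X2X1|].
  have [k1 Hk1] := dec1 (rcons w m) (fZ j).
  apply: (@acc_pieces q p1 k1) => // u qu.
  have [//|ru] := Hk1 u (qp1 _ qu).
  case: (rej2_not_target pq qp1 HX2 (rejZ j (ltnW hj)) qu).
  split; first by rewrite size_mkseq.
  by exists m; rewrite size_mkseq; split=> //; exists k1.
have := HL (mkseq Z j, m) accj Z bZ; rewrite /= size_mkseq => /(_ erefl).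
apply; last first.
  exists t'; split=> //; exists z; split=> // i.
  rewrite size_rcons ltnS leq_eqVlt nth_rcons => /orP[/eqP ->|iw].
    by rewrite ltnn eqxx.
  by rewrite iw zw.
move=> i ji; have [sp ab] := HZ i (leq_trans (ltnW hj) ji); split=> //.
have [_ /(_ j m ji)] := Hs _ _ _ ab; apply.
by rewrite size_mkseq hj ltnS.
Qed.

(** Position, witness segment, length of the position at which the current plan was adopted, and
    what remains of that plan. *)
Let state := (seq E * seq nat * nat * plan F)%type.

Definition good_state t (s : state) := [/\ finsupps s.1.1.1,
  reaches X3 (target (s.1.2, s.1.1.2) t) s.1.1.1 s.2 & s.2 <> Stop F].

Definition play t (s : state) y (s' : state) := s'.1.1.1 = rcons s.1.1.1 y /\
  ((s'.1.1.2 = s.1.1.2 /\ subplan s'.2 s.2) \/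
   (exists m, s'.1.1.2 = rcons s.1.1.2 m /\ bad t s'.1.1.1 s'.1.1.2)).

Lemma bad_plan t h w : p3 t -> finsupps h -> bad t h w -> exists a,
  good_state t (h, w, size h, a).
Proof.
move=> p3t fh bh; have [a Ha] := bad_Reach p3t fh bh; exists a; split=> //= aS.
by move: Ha; rewrite aS => -[/=]; rewrite ltnn.
Qed.

(** When the rest of the plan is [Stop], the target is reached: the witness segment grows, and
    [bad_plan] supplies a plan from the new bad position. *)
Lemma good_state_next t s : p3 t -> good_state t s ->
  some_of X3 (fun y => exists s', play t s y s' /\ good_state t s').
Proof.
case: s => [[[h w] n] a] p3t [/= fh]; case: a => [|f g] // Ha _ Z bZ ZX.
have [sp nz Hg] := Ha Z bZ ZX; exists (f Z); split=> //.
have fz : finsupps (rcons h (f Z)).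
  by apply: finsupps_rcons => //; apply: finsupp_span sp.
case gZ : (g Z) Hg => [|f' g'] Hg.
  have [/= _ [m [_ bm]]] := Hg; have [a' Ha'] := bad_plan p3t fz bm.
  exists (rcons h (f Z), rcons w m, size (rcons h (f Z)), a'); split=> //.
  by split=> //; right; exists m.
exists (rcons h (f Z), w, n, g Z); rewrite gZ; split=> //; split=> //; left.
by split=> //; exists f, g, Z; rewrite gZ.
Qed.

(** Plans are well founded, so the witness segment grows without bound and defines [z]. Badness at
    arbitrarily late positions gives points of [C] approximating [t], the outcome and [z], and
    [closedC] applies. *)
Lemma II_wins t : p3 t -> bad t [::] [::] -> exists alpha,
  II_strategy_G X3 alpha /\
  forall Ys, I_play_G X3 Ys -> exists z, C t (outcome_G alpha Ys) z.
Proof.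
move=> p3t bt; have [a0 g0] := bad_plan p3t (@finsupps_nil F) bt.
have [|alpha [Ha1 Ha2]] := @II_strategy_of_step F state X3 (good_state t) (play t)
  _ g0.
  by move=> s gs; apply: good_state_next.
exists alpha; split=> // Ys HYs; have [S [S0 HS]] := Ha2 Ys HYs.
set Y := outcome_G alpha Ys in HS *.
have SE k : (S k).1.1.1 = mkseq Y k.
  elim: k => [|k IHk]; first by rewrite S0.
  by rewrite mkseqS -IHk; case: (HS k) => _ [].
pose W k := (S k).1.1.2.
have W_S k : W k.+1 = W k \/ exists m, W k.+1 = rcons (W k) m.
  by rewrite /W; have [_ [_ [[-> _]|[m [-> _]]]]] := HS k; [left|right; exists m].
have pre k j : (k <= j)%N -> (size (W k) <= size (W j))%N /\
    forall i, (i < size (W k))%N -> nth 0%N (W j) i = nth 0%N (W k) i.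
  elim: j => [|j IHj]; first by rewrite leqn0 => /eqP ->.
  rewrite leq_eqVlt => /orP[/eqP -> //|/IHj [sj nj]].
  have [->//|[m ->]] := W_S j; split; first by rewrite size_rcons ltnW.
  by move=> i ik; rewrite nth_rcons (leq_trans ik sj) nj.
have progress k : exists j, [/\ (k < j)%N, (size (W k) < size (W j))%N &
    bad t (mkseq Y j) (W j)].
  apply: contrapT => nj; apply: (@no_infinite_subplan F (fun i => (S (k + i)%N).2)).
  move=> i; rewrite addnS; have [_ [_ [[_ //]|[m [Wm bm]]]]] := HS (k + i)%N.
  case: nj; exists (k + i).+1; split; first by rewrite ltnS leq_addr.
    by rewrite /W Wm size_rcons ltnS; have [] := pre k (k + i)%N (leq_addr _ _).
  by rewrite -SE.
have far n : exists j, [/\ (n <= j)%N, (n <= size (W j))%N &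
    bad t (mkseq Y j) (W j)].
  elim: n => [|n [j [nj nW _]]]; first by have [j [_ _ bj]] := progress 0%N; exists j.
  have [j' [jj' WW bj']] := progress j; exists j'; split=> //.
    exact: leq_ltn_trans jj'.
  exact: leq_ltn_trans WW.
have [kk Hkk] : {kk : nat -> nat & forall i, (i < size (W (kk i)))%N}.
  apply: (@choice _ _ (fun i k => (i < size (W k))%N)) => i.
  by have [j [_ Wj _]] := far i.+1; exists j.
pose z i := nth 0%N (W (kk i)) i.
have zE k i : (i < size (W k))%N -> nth 0%N (W k) i = z i.
  move=> ik; have [_ e1] := pre k (maxn k (kk i)) (leq_maxl _ _).
  have [_ e2] := pre (kk i) (maxn k (kk i)) (leq_maxr _ _).
  by rewrite /z -e1 // -e2.
exists z; apply: closedC => n; have [j [nj nW [k rk]]] := far n.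
(* Length [maxn k n] keeps the parameter inside the rejected piece and makes it agree with [t] on
   [n] bits. *)
have nacc : ~ acc (piece p3 (maxn k n) t) X3 (mkseq Y j) (W j).
  apply: (rk (piece p3 (maxn k n) t) X3) => //.
  - exact: perf_piece_mem.
  - by move=> u [/p3p2 /p2p1 p1u a]; split=> //; apply: agreeW a; apply: leq_maxl.
  exact: ae_trans X3X2 X2X1.
have [Z [bZ]] := not_Iwin nacc; rewrite size_mkseq => ZY [t' [[p3t' a]]].
move=> [z' [z'W Cz']]; exists t', Z, z'; split=> //.
  by apply: agreeW a; apply: leq_maxr.
move=> i ni; split.
  have ij := leq_trans ni nj.
  by have := congr1 (fun l => nth (fun=> 0) l i) ZY; rewrite !nth_mkseq.
by have iW := leq_trans ni nW; rewrite z'W // zE.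
Qed.

End Decided3.
End Decided2.
End Decided.

(** Acceptance of the empty position at some condition gives I's alternative. Otherwise three
    fusions, deciding in turn witness segments, reachability of targets and the next vector, supply
    the hypotheses of [II_wins]. *)
Lemma cantor_dichotomy : exists p X, [/\ perf p, H X &
  (exists sigma, forall t Y, p t -> outcomes_F X sigma Y -> ~ exists z, C t Y z) \/
  forall t, p t -> exists alpha, II_strategy_G X alpha /\
    forall Ys, I_play_G X Ys -> exists z, C t (outcome_G alpha Ys) z].
Proof.
have [_ [[X0 HX0] _]] := famH.
have [rj|/existsNP[q /existsNP[Y]]] := EM (rej (fun=> True) X0 [::] [::]); last first.
  move=> /not_implyP[pq /not_implyP[_ /not_implyP[HY /not_implyP[_ /contrapT aq]]]].
  have [s Hs] := aq; exists q, Y; split=> //; left; exists s => t Z qt.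
  move=> [bZ [spZ abZ]] [z Cz]; apply: (Hs Z) => // [k _|].
    by split; [apply: spZ|apply: abZ].
  by exists t; split=> //; exists z.
have [||p1 [X1 [pp1 _ HX1 X1X0 dec1]]] := @fusion F H famH pH (seq nat)
  (fun h w q Y => acc q Y h w \/ rej q Y h w) _ X0 perfT HX0.
- move=> h w q q' Y Y' q'q _ _ Y'Y [a|r]; first by left; apply: acc_sub a.
  by right; apply: rej_sub r.
- move=> h w q Y fh pq _ HY YX.
  have [r|/existsNP[q' /existsNP[Y']]] := EM (rej q Y h w).
    by exists q, Y; split=> //; [apply: ae_refl|right].
  move=> /not_implyP[pq' /not_implyP[q'q /not_implyP[HY' /not_implyP[Y'Y]]]].
  by move=> /contrapT a; exists q', Y'; split=> //; left.
have [||p2 [X2 [pp2 p2p1 HX2 X2X1 dec2]]] := @fusion F H famH pH (nat * seq nat)%type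
  (fun h r q Y => acc2 p1 X1 r q Y h \/ rej2 p1 X1 r q Y h) _ X1 pp1 HX1.
- move=> h r q q' Y Y' q'q _ _ Y'Y [a|rr]; first by left; apply: acc2_sub a.
  by right; apply: rej2_sub rr.
- move=> h r q Y fh pq _ HY YX.
  have [rr|/existsNP[q' /existsNP[Y']]] := EM (rej2 p1 X1 r q Y h).
    by exists q, Y; split=> //; [apply: ae_refl|right].
  move=> /not_implyP[pq' /not_implyP[q'q /not_implyP[HY' /not_implyP[Y'Y]]]].
  by move=> /contrapT a; exists q', Y'; split=> //; left.
have [||p3 [X3 [pp3 p3p2 HX3 X3X2 dec3]]] := @fusion F H famH pH (nat * seq nat)%type
  (fun h r q Y => next_decided p1 X1 X2 r h q Y) _ X2 pp2 HX2.
- move=> h r q q' Y Y' q'q _ _ Y'Y [a|rr]; first by left; apply: acc2_sub a.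
  right; apply: all_of_ae Y'Y _; apply: all_of_sub rr => y.
  by apply: rej2_sub => //; apply: ae_refl.
- move=> h r q Y fh pq qp2 HY YX2; by apply: (next_decided_dense dec2).
exists p3, X3; split=> //; right=> t p3t.
apply: (II_wins dec1 p2p1 X2X1 dec2 pp3 HX3 HX2 p3p2 X3X2 dec3 p3t).
(* The piece of length 0 is all of [p1], so the empty position is bad at every [t]. *)
by exists 0%N; apply: rej_sub rj.
Qed.

End Dichotomy.

(** * Transfer to the real line *)


Section CantorMap.
Variable R : realType.
Implicit Types (t : nat -> bool).

Definition cantor_partial t n : R := \sum_(i < n) (t i)%:R * 2 * 3^-1 ^+ i.+1.

Definition cantor_map t : R := sup (fun x => exists n, x = cantor_partial t n).

Lemma thirdX_gt0 n : 0 < 3^-1 ^+ n :> R.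
Proof. by rewrite exprn_gt0 // invr_gt0. Qed.

Lemma thirdX_ge m n : (m <= n)%N -> 3^-1 ^+ n <= 3^-1 ^+ m :> R.
Proof.
by move=> mn; apply: ler_wiXn2l => //; rewrite ?invr_ge0 ?invf_le1 ?ler1n.
Qed.

Lemma thirdX_small (e : R) : 0 < e -> exists n, 3^-1 ^+ n < e.
Proof.
move=> e0; pose n := Num.bound e^-1; exists n.
have le3 : n%:R <= 3 ^+ n :> R.
  by rewrite -natrX ler_nat ltnW // ltn_expl.
have en : e^-1 < n%:R.
  by have := archi_boundP (ltW (_ : 0 < e^-1)); apply; rewrite invr_gt0.
by rewrite exprVn -[e]invrK ltf_pV2 ?posrE ?exprn_gt0 ?invr_gt0 // (lt_le_trans en).
Qed.

Lemma cantor_partialS t n :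
  cantor_partial t n.+1 = cantor_partial t n + (t n)%:R * 2 * 3^-1 ^+ n.+1.
Proof. by rewrite /cantor_partial big_ord_recr. Qed.

(** The subtracted power makes the bound an exact geometric sum, which carries the induction. *)
Lemma cantor_partial_le t n j :
  cantor_partial t n <= cantor_partial t (n + j) <=
  cantor_partial t n + 3^-1 ^+ n - 3^-1 ^+ (n + j).
Proof.
elim: j => [|j /andP[IH1 IH2]]; first by rewrite addn0; lra.
rewrite addnS cantor_partialS exprS; have := thirdX_gt0 (n + j).
by case: (t _) => /=; rewrite ?mul1r ?mul0r => p0; apply/andP; split; lra.
Qed.

Lemma cantor_map_bounds t n :
  cantor_partial t n <= cantor_map t <= cantor_partial t n + 3^-1 ^+ n.
Proof.
have ub m : cantor_partial t m <= cantor_partial t n + 3^-1 ^+ n.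
  case: (leqP n m) => [nm|/ltnW mn].
    have /andP[_] := cantor_partial_le t n (m - n); rewrite subnKC //.
    by have := thirdX_gt0 m; lra.
  have /andP[+ _] := cantor_partial_le t m (n - m); rewrite subnKC //.
  by have := thirdX_gt0 n; lra.
apply/andP; split.
  apply: sup_upper_bound; last by exists n.
  split; first by exists (cantor_partial t 0), 0%N.
  by exists (cantor_partial t n + 3^-1 ^+ n) => _ [m ->].
apply: ge_sup; first by exists (cantor_partial t 0), 0%N.
by move=> _ [m ->].
Qed.

Lemma cantor_partial_agree n t t' : agree n t t' ->
  cantor_partial t n = cantor_partial t' n.
Proof. by move=> a; apply: eq_bigr => i _; rewrite a. Qed.

Lemma cantor_map_agree n t t' : agree n t t' ->
  `|cantor_map t - cantor_map t'| <= 3^-1 ^+ n.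
Proof.
move=> a; have := cantor_map_bounds t n; have := cantor_map_bounds t' n.
by rewrite (cantor_partial_agree a) ler_norml => /andP[? ?] /andP[? ?]; lra.
Qed.

(** A first difference at digit [m] separates the images by at least $3^{-(m+1)}$, the gap left by
    the missing digit 1. *)
Lemma cantor_map_close n t t' :
  `|cantor_map t - cantor_map t'| < 3^-1 ^+ n -> agree n t t'.
Proof.
rewrite ltr_norml => close; suff H m : (m <= n)%N -> agree m t t' by apply: H.
elim: m => // m IHm mn i; have am := IHm (ltnW mn).
rewrite ltnS leq_eqVlt => /orP[/eqP ->|]; last exact: am.
have := cantor_map_bounds t m.+1; have := cantor_map_bounds t' m.+1.
rewrite !cantor_partialS (cantor_partial_agree am).
have := thirdX_ge mn; move: close; have := thirdX_gt0 m.+1.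
case: (t m); case: (t' m) => //= p0 /andP[? ?] ? /andP[? ?] /andP[? ?]; exfalso; lra.
Qed.

Lemma perfect_image p : perf p ->
  nonempty_perfect (fun r : R => exists t, p t /\ cantor_map t = r).
Proof.
move=> [[t0 pt0] pC pI]; split; first by exists (cantor_map t0), t0.
split=> [r Hr|_ [t [pt <-]] e e0].
  (* The half makes the images of [u m] and [u n] closer than $3^{-m}$ for [m <= n], so the sequence
     stabilizes bit by bit. *)
  have [u Hu] : {u : nat -> nat -> bool & forall n, p (u n) /\
      `|cantor_map (u n) - r| < 3^-1 ^+ n / 2}.
    apply: (@choice _ _ (fun n t => p t /\ `|cantor_map t - r| < 3^-1 ^+ n / 2)).
    move=> n; have [|_ [[t [pt <-]] d]] := Hr (3^-1 ^+ n / 2).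
      by rewrite divr_gt0 ?thirdX_gt0.
    by exists t.
  have au m n : (m <= n)%N -> agree m (u m) (u n).
    move=> mn; apply: cantor_map_close.
    have [_ dm] := Hu m; have [_ dn] := Hu n; have := thirdX_ge mn.
    move: dm dn; rewrite !ltr_norml => /andP[? ?] /andP[? ?] ?.
    by apply/andP; split; lra.
  pose t i := u i.+1 i.
  have at_ n : agree n t (u n) by move=> i ik; rewrite /t (au i.+1 n).
  exists t; split.
    by apply: pC => n; exists (u n); split; [case: (Hu n)|].
  apply/eqP; rewrite -subr_eq0 -normr_le0; apply/ler_addgt0Pl => e e0; rewrite addr0.
  have [|n ne] := @thirdX_small (e / 2); first by lra.
  have [_ dn] := Hu n; have dt := cantor_map_agree (at_ n).
  have := thirdX_gt0 n; move: dn dt; rewrite ltr_norml !ler_norml.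
  by move=> /andP[? ?] /andP[? ?] ?; apply/andP; split; lra.
have [n ne] := thirdX_small e0.
have [t' [pt' a tt']] := pI t n pt.
exists (cantor_map t'); split; first by exists t'.
split.
  apply/eqP => gg; have [i Hi] := neq_index tt'; apply: Hi.
  have /cantor_map_close : `|cantor_map t' - cantor_map t| < 3^-1 ^+ i.+1.
    by rewrite gg subrr normr0 thirdX_gt0.
  exact.
by apply: le_lt_trans (cantor_map_agree (agree_sym a)) ne.
Qed.

End CantorMap.

Theorem theorem1p8 (F : countFieldType) (R : realType)
    (H : (nat -> vec F) -> Prop) (A : R -> (nat -> vec F) -> Prop) :
  is_family H -> strategic H -> pplus_family H ->
  (forall t Y, A t Y -> is_block Y) ->
  analytic_RxE A ->
  exists (P : R -> Prop) (X : nat -> vec F),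
    nonempty_perfect P /\ H X /\
    ((exists sigma : seq (vec F) -> nat,
        forall t Y, P t -> outcomes_F X sigma Y -> ~ A t Y)
     \/
     (forall t, P t -> exists alpha, II_strategy_G X alpha /\
        forall Ys, I_play_G X Ys -> A t (outcome_G alpha Ys))).
Proof.
move=> famH stratH [pH fullH] _ [C [closedC AE]].
have [|p [X [pp HX Hdich]]] := @cantor_dichotomy F H famH stratH pH fullH
    (fun t => C (cantor_map R t)).
  (* Agreement on [m] bits becomes distance at most $3^{-m}$, so closedness over the reals pulls
     back to the Cantor space. *)
  move=> t x z Htxz; apply: closedC => e n e0.
  have [m me] := thirdX_small e0.
  have [t' [x' [z' [Cz a xz]]]] := Htxz (maxn m n).
  exists (cantor_map R t'), x', z'; split=> //; split.
    apply: le_lt_trans me; apply: cantor_map_agree; apply: agree_sym.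
    by apply: agreeW a; apply: leq_maxl.
  by move=> i ni; apply: xz; rewrite leq_max ni orbT.
exists (fun r => exists t, p t /\ cantor_map R t = r), X.
split; first exact: perfect_image.
split=> //; case: Hdich => [[sigma Hs]|Hs]; [left|right].
  exists sigma => _ Y [t [pt <-]] out /AE; exact: Hs.
move=> _ [t [pt <-]]; have [alpha [Ha1 Ha2]] := Hs t pt.
by exists alpha; split=> // Ys /Ha2 ?; apply/AE.
Qed.
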